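(* (a) For every $n\in\mathbb N$ there is a Banach space $X_n$ with the Daugavet property such that $$\operatorname{Daug}_n\Bigl(X_n,\frac14\Bigr)\ge\frac12 .$$ (b) There is a Banach space $X$ which has the Daugavet property, but does not have the uniform Daugavet property. (c) An ultrapower of a space with the Daugavet property does not necessarily possess the Daugavet property; that is, there are a Banach space $X$ with the Daugavet property and a free ultrafilter $\mathcal U$ on $\mathbb N$ such that the ultrapower $X^{\mathcal U}$ does not have the Daugavet property.
   Context: Banach spaces are real and nonzero. A Banach space $X$ has the Daugavet property if every bounded linear rank-$1$ operator $T:X\to X$ satisfies $\|\mathrm{Id}+T\|=1+\|T\|$. $S(X)$ denotes the unit sphere of $X$. For $x\in S(X)$ and $\varepsilon>0$ put $$l^+(x,\varepsilon)=\{y\in S(X):\ \|x+y\|\ge 2-\varepsilon\}.$$ For $A\subset X$ and $n\in\mathbb N$, $\operatorname{conv}_n(A)$ is the set of all convex combinations $\sum_{k=1}^n\lambda_k a_k$ with $a_1,\dots,a_n\in A$ (not necessarily distinct), $\lambda_k\ge 0$, $\sum_{k=1}^n\lambda_k=1$. Put $$\operatorname{Daug}_n(X,\varepsilon)=\sup_{x,y\in S(X)}\operatorname{dist}\bigl(\operatorname{conv}_n(l^+(x,\varepsilon)),y\bigr),$$ where $\operatorname{dist}(A,y)=\inf\{\|a-y\|:a\in A\}$. The space $X$ has the uniform Daugavet property if for every $\varepsilon>0$ the sequence $(\operatorname{Daug}_n(X,\varepsilon))_n$ tends to $0$ as $n\to\infty$. For a free ultrafilter $\mathcal U$ on $\mathbb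 N$, the ultrapower $X^{\mathcal U}$ is the quotient of $\ell_\infty(\mathbb N,X)$ by the closed subspace of sequences $(x_i)$ with $\lim_{\mathcal U}\|x_i\|=0$, with norm $\|[(x_i)]\|=\lim_{\mathcal U}\|x_i\|$. *)

(* Defs.v *)
From HB Require Import structures.
From mathcomp Require Import all_boot all_order all_algebra.
From mathcomp Require Import generic_quotient ring_quotient.
From mathcomp Require Import all_classical all_reals all_analysis.

Set Implicit Arguments.
Unset Strict Implicit.
Unset Printing Implicit Defensive.

Import Order.TTheory GRing.Theory Num.Theory.
Import numFieldNormedType.Exports.

Local Open Scope classical_set_scope.
Local Open Scope ring_scope.

Section Daugavet.
Variables (R : realType) (X : normedModType R).

Definition nonzero_space : Prop := exists x : X, x != 0.

Definition bounded_operator (T : X -> X) : Prop :=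
  exists M : R, forall x, `|T x| <= M * `|x|.

Definition opnorm (T : X -> X) : R :=
  sup [set `|T x| | x in [set x : X | `|x| <= 1]].

Definition rank_one (T : X -> X) : Prop :=
  exists2 v : X, v != 0 & range T = [set a *: v | a in [set: R]].

Definition Daugavet_property : Prop :=
  forall T : {linear X -> X}, bounded_operator T -> rank_one T ->
    opnorm (fun x => x + T x) = 1 + opnorm T.

Definition unit_sphere : set X := [set x | `|x| = 1].

Definition lplus (x : X) (e : R) : set X :=
  [set y | unit_sphere y /\ 2 - e <= `|x + y|].

Definition convn (n : nat) (A : set X) : set X :=
  [set z | exists (a : 'I_n -> X) (l : 'I_n -> R),
     [/\ forall k, A (a k), forall k, 0 <= l k, \sum_(k < n) l k = 1
       & z = \sum_(k < n) l k *: a k]].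

(* Extended-real valued, so that the infimum over the empty set is +oo. *)
Definition dist_set (A : set X) (y : X) : \bar R :=
  ereal_inf [set (`|a - y|)%:E | a in A].

Definition Daug (n : nat) (e : R) : \bar R :=
  ereal_sup [set dist_set (convn n (lplus p.1 e)) p.2
            | p in unit_sphere `*` unit_sphere].

Definition uniform_Daugavet_property : Prop :=
  forall e : R, 0 < e -> Daug n e @[n --> \oo] --> 0%E.

End Daugavet.
Arguments nonzero_space {R} X.
Arguments Daugavet_property {R} X.
Arguments unit_sphere {R} X.
Arguments Daug {R} X.
Arguments uniform_Daugavet_property {R} X.

Record freeUltrafilter := FreeUltrafilter {
  fu_sets : set_system nat;
  fu_ultra : UltraFilter fu_sets;
  fu_free : \bigcap_(A in fu_sets) A = set0
}.
#[global] Existing Instance fu_ultra.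

Section FreeUltrafilterTheory.
Variable U : freeUltrafilter.

Lemma fu_neq (k : nat) : fu_sets U [set i | i != k].
Proof.
have [|//] := in_ultra_setVsetC [set k] (fu_ultra U).
  move=> Uk; exfalso.
  suff: (\bigcap_(A in fu_sets U) A) k by rewrite fu_free.
  move=> A UA; have UkA : fu_sets U ([set k] `&` A) by exact: filterI.
  by have [_ [->]] := filter_ex UkA.
by apply: filterS => i /= /eqP.
Qed.

Lemma fu_geq (m : nat) : fu_sets U [set i | (m <= i)%N].
Proof.
elim: m => [|m IH]; first exact: filterS filterT.
apply: filterS2 IH (fu_neq m) => i /= mi im.
by rewrite ltn_neqAle eq_sym im.
Qed.

Lemma fu_cvg (R : realType) (f : nat -> R) (M : R) :
  (forall i, `|f i| <= M) -> cvg (f i @[i --> fu_sets U]).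
Proof.
move=> fM.
have ultra : UltraFilter (f @ fu_sets U).
  split; first exact: fmap_proper_filter.
  move=> G PG UG; apply/seteqP; split => // A GA.
  have [//|UnA] := in_ultra_setVsetC (f @^-1` A) (fu_ultra U).
  have /UG GnA : (f @ fu_sets U) (~` A) by exact: UnA.
  have GI : G (A `&` ~` A) by exact: filterI.
  by have [x []] := filter_ex GI.
have := @segment_compact R (- M) M; rewrite compact_ultra => /(_ (f @ fu_sets U) ultra).
case=> [|l [_ fl]]; last by apply/cvg_ex; exists l.
suff: fu_sets U [set i | `[- M, M]%classic (f i)] by [].
apply: filterS filterT => i _ /=.
by rewrite in_itv/= -ler_norml.
Qed.

End FreeUltrafilterTheory.

Section Linfty.
Variables (R : realType) (X : normedModType R).

Definition bounded_seq : {pred (nat -> X)} :=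
  [pred x | `[< exists M : R, forall i, `|x i| <= M >]].

Lemma bounded_seq_submod_closed : submod_closed bounded_seq.
Proof.
split=> [|a x y /asboolP[M xM] /asboolP[N yN]]; apply/asboolP.
  by exists 0 => i; rewrite normr0.
exists (`|a| * M + N) => i; rewrite (le_trans (ler_normD _ _))// lerD//.
by rewrite normrZ ler_wpM2l.
Qed.
HB.instance Definition _ :=
  GRing.isSubmodClosed.Build R (nat -> X) bounded_seq bounded_seq_submod_closed.

Record linfty := Linfty {
  linfty_val :> nat -> X;
  linfty_valP : linfty_val \in bounded_seq
}.
HB.instance Definition _ := [isSub for linfty_val].
HB.instance Definition _ := [Choice of linfty by <:].
HB.instance Definition _ := [SubChoice_isSubLmodule of linfty by <:].

Lemma linfty0E i : (0 : linfty) i = 0. Proof. by []. Qed.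
Lemma linftyDE (x y : linfty) i : (x + y) i = x i + y i. Proof. by []. Qed.
Lemma linftyNE (x : linfty) i : (- x) i = - x i. Proof. by []. Qed.
Lemma linftyZE a (x : linfty) i : (a *: x) i = a *: x i. Proof. by []. Qed.

End Linfty.
Arguments linfty {R} X.

Section Ultrapower.
Variables (R : realType) (X : normedModType R) (U : freeUltrafilter).
Implicit Types (x y : linfty X) (a : R).

Definition ulim_norm x : R := lim (`|x i| @[i --> fu_sets U]).

Lemma ulim_normP x : `|x i| @[i --> fu_sets U] --> ulim_norm x.
Proof.
have /asboolP[M xM] := linfty_valP x.
by apply: (@fu_cvg U R _ M) => i; rewrite normr_id.
Qed.
Arguments ulim_normP x : clear implicits.

Lemma ulim_norm_eq x l : `|x i| @[i --> fu_sets U] --> l -> ulim_norm x = l.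
Proof. exact: cvg_lim. Qed.

Lemma ulim_norm_ge0 x : 0 <= ulim_norm x.
Proof.
by apply: limr_ge (cvgP _ (ulim_normP x)) _; apply: nearW => i; exact: normr_ge0.
Qed.

Lemma ulim_norm_le x (c : R) :
  (\forall i \near fu_sets U, `|x i| <= c) -> ulim_norm x <= c.
Proof. exact: (limr_le (cvgP _ (ulim_normP x))). Qed.

Lemma ulim_normD x y : ulim_norm (x + y) <= ulim_norm x + ulim_norm y.
Proof.
apply: (ler_cvg_to (ulim_normP (x + y)) (cvgD (ulim_normP x) (ulim_normP y))).
by apply: nearW => i; exact: ler_normD.
Qed.

Lemma ulim_normZ a x : ulim_norm (a *: x) = `|a| * ulim_norm x.
Proof.
apply: ulim_norm_eq.
rewrite (_ : (fun i => _) = (fun i => `|a| * `|x i|)); last first.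
  by apply/funext => i; rewrite -normrZ.
by apply: cvgMl_tmp; exact: ulim_normP.
Qed.

Lemma ulim_normN x : ulim_norm (- x) = ulim_norm x.
Proof. by rewrite -scaleN1r ulim_normZ normrN normr1 mul1r. Qed.

Definition null_seq : {pred (linfty X)} :=
  [pred x : linfty X | `[< `|x i| @[i --> fu_sets U] --> (0 : R) >]].

Lemma null_seqE x : (x \in null_seq) = (ulim_norm x == 0).
Proof.
apply/asboolP/eqP => [|x0]; first exact: ulim_norm_eq.
by rewrite -x0; exact: ulim_normP.
Qed.

Lemma null_seq_submod_closed : submod_closed null_seq.
Proof.
split=> [|a x y]; rewrite !null_seqE.
  by rewrite -(scale0r (0 : linfty X)) ulim_normZ normr0 mul0r.
move=> /eqP x0 /eqP y0; rewrite eq_le ulim_norm_ge0 andbT.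
by rewrite (le_trans (ulim_normD _ _))// ulim_normZ x0 y0 mulr0 addr0.
Qed.
HB.instance Definition _ :=
  GRing.isSubmodClosed.Build R (linfty X) null_seq null_seq_submod_closed.

Definition ultrapower : Type := Quotient.quot null_seq.
HB.instance Definition _ := GRing.Zmodule.on ultrapower.

Definition up_class (x : linfty X) : ultrapower := (\pi_(Quotient.quot null_seq) x)%qT.
Definition up_repr (q : ultrapower) : linfty X := repr (q : Quotient.quot null_seq).

Lemma up_reprK : cancel up_repr up_class.
Proof. by move=> q; exact: reprK. Qed.

Lemma up_classP x y : up_class x = up_class y <-> ulim_norm (x - y) = 0.
Proof.
by split=> [/eqP|/eqP xy]; [|apply/eqP];
  rewrite /up_class -Quotient.idealrBE null_seqE// => /eqP.
Qed.

Lemma up_classD x y : up_class (x + y) = up_class x + up_class y.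
Proof. exact: (Quotient.pi_add null_seq). Qed.

Lemma up_classB x y : up_class (x - y) = up_class x - up_class y.
Proof. exact: (raddfB (\pi_(Quotient.quot null_seq))%qT). Qed.

Lemma up_class0 : up_class 0 = 0.
Proof. exact: (raddf0 (\pi_(Quotient.quot null_seq))%qT). Qed.

Definition up_scale a (q : ultrapower) : ultrapower := up_class (a *: up_repr q).

Lemma up_classZ a x : up_class (a *: x) = up_scale a (up_class x).
Proof.
apply/up_classP; rewrite -scalerBr ulim_normZ.
suff -> : ulim_norm (x - up_repr (up_class x)) = 0 by rewrite mulr0.
by apply/up_classP; rewrite up_reprK.
Qed.

Lemma up_scaleA a b q : up_scale a (up_scale b q) = up_scale (a * b) q.
Proof. by rewrite -(up_reprK q) -!up_classZ scalerA. Qed.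

Lemma up_scale1 : left_id 1 up_scale.
Proof. by move=> q; rewrite -(up_reprK q) -up_classZ scale1r. Qed.

Lemma up_scaleDr : right_distributive up_scale +%R.
Proof.
move=> a p q; rewrite -(up_reprK p) -(up_reprK q) -!(up_classD, up_classZ).
by rewrite scalerDr.
Qed.

Lemma up_scaleDl q : {morph up_scale^~ q : a b / a + b}.
Proof.
by move=> a b; rewrite -(up_reprK q) -!up_classZ -up_classD scalerDl.
Qed.

HB.instance Definition _ := GRing.Zmodule_isLmodule.Build R ultrapower
  up_scaleA up_scale1 up_scaleDr up_scaleDl.

Definition up_norm (q : ultrapower) : R := ulim_norm (up_repr q).

Lemma up_norm_class x : up_norm (up_class x) = ulim_norm x.
Proof.
have e y z : ulim_norm (y - z) = 0 -> ulim_norm y <= ulim_norm z.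
  by move=> yz; rewrite -[y](subrK z) (le_trans (ulim_normD _ _))// yz add0r.
have xx : ulim_norm (x - up_repr (up_class x)) = 0.
  by apply/up_classP; rewrite up_reprK.
by apply/eqP; rewrite eq_le !e// -ulim_normN opprB.
Qed.

Lemma up_normD p q : up_norm (p + q) <= up_norm p + up_norm q.
Proof.
by rewrite -(up_reprK p) -(up_reprK q) -up_classD !up_norm_class ulim_normD.
Qed.

Lemma up_normZ a q : up_norm (a *: q) = `|a| * up_norm q.
Proof.
rewrite -(up_reprK q).
by rewrite -[a *: _]/(up_scale a _) -up_classZ !up_norm_class ulim_normZ.
Qed.

Lemma up_norm0_eq0 q : up_norm q = 0 -> q = 0.
Proof.
rewrite -(up_reprK q) up_norm_class => q0; rewrite -up_class0.
by apply/up_classP; rewrite subr0.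
Qed.

HB.instance Definition _ :=
  Lmodule_isNormed.Build R ultrapower up_normD up_normZ up_norm0_eq0.

Lemma up_normE x : `|up_class x| = ulim_norm x.
Proof. exact: up_norm_class. Qed.

Lemma up_complete (F : set_system (ultrapower)) :
  ProperFilter F -> cauchy F -> cvg F.
Proof.
move=> PF /cauchyP Fc.
pose e (n : nat) : R := n.+1%:R^-1.
have e0 n : 0 < e n by rewrite invr_gt0.
have eD m n : (m <= n)%N -> e n <= e m by move=> mn; rewrite lef_pV2 ?posrE// ler_nat.
have /choice[q Fq] : forall n, exists q, F (ball q (e n)) by move=> n; exact: Fc.
pose r n := up_repr (q n).
pose ok i n := `[< forall m, (m <= n)%N -> `|r m i - r n i| <= 2 * e m >].
have ok0 i : exists n, (n <= i)%N && ok i n.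
  exists 0%N; apply/asboolP => m; rewrite leqn0 => /eqP ->.
  by rewrite subrr normr0 mulr_ge0// ltW.
have N_ex i : {n | (n <= i)%N && ok i n & forall k, (k <= i)%N && ok i k -> (k <= n)%N}.
  have le n : (n <= i)%N && ok i n -> (n <= i)%N by case/andP.
  by exists (ex_maxn (ok0 i) le); case: ex_maxnP.
pose N i := s2val (N_ex i).
have okN i : ok i (N i) by have /andP[] := s2valP (N_ex i).
have Nmax i k : (k <= i)%N -> ok i k -> (k <= N i)%N.
  by move=> ki oki; apply: (s2valP' (N_ex i)); rewrite ki.
have y_bnd : (fun i => r (N i) i) \in @bounded_seq R X.
  have /asboolP[M rM] := linfty_valP (r 0%N).
  apply/asboolP; exists (2 * e 0%N + M) => i.
  rewrite -[r (N i) i](subrK (r 0%N i)) (le_trans (ler_normD _ _))// lerD//.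
  by rewrite distrC; move/asboolP : (okN i); apply.
pose y := Linfty y_bnd.
have near_ok k m : (m <= k)%N -> \forall i \near fu_sets U, `|r m i - r k i| <= 2 * e m.
  move=> mk; have : ulim_norm (r m - r k) < 2 * e m.
    have FI : F (ball (q m) (e m) `&` ball (q k) (e k)) by exact: filterI.
    have [z [/= qmz qkz]] := filter_ex FI.
    have -> : ulim_norm (r m - r k) = `|q m - q k|.
      by rewrite -up_normE up_classB !up_reprK.
    rewrite -ball_normE/= in qmz; rewrite -ball_normE/= in qkz.
    rewrite -(subrK z (q m)) -addrA (le_lt_trans (ler_normD _ _))//.
    rewrite mulr_natl mulr2n ltrD// distrC (lt_le_trans qkz)//.
    exact: eD.
  move=> lt_e.
  have : fu_sets U [set i | `|(r m - r k) i| < 2 * e m].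
    exact: (cvgr_lt _ (ulim_normP (r m - r k)) _ lt_e).
  by apply: filterS => i /= /ltW.
have near_okk k : \forall i \near fu_sets U, ok i k.
  suff H n : (n <= k)%N -> \forall i \near fu_sets U,
      forall m, (m <= n)%N -> `|r m i - r k i| <= 2 * e m.
    by apply: filterS (H k (leqnn k)) => i ?; apply/asboolP.
  elim: n => [_|n IH nk].
    by apply: filterS (near_ok k 0%N (leq0n k)) => i ? m; rewrite leqn0 => /eqP ->.
  apply: filterS2 (IH (ltnW nk)) (near_ok k n.+1 nk) => i Hn Hn1 m.
  by rewrite leq_eqVlt ltnS => /orP[/eqP ->|/Hn].
have qy k : `|q k - up_class y| <= 2 * e k.
  rewrite -(up_reprK (q k)) -up_classB up_normE.
  apply: ulim_norm_le; apply: filterS2 (fu_geq U k) (near_okk k) => i ki oki.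
  by move/asboolP : (okN i); apply; exact: Nmax.
apply/cvg_ex; exists (up_class y); apply/fcvg_ballP => eps eps0.
have [k _ /(_ k (leqnn k)) ek] := near_infty_natSinv_lt (PosNum (divr_gt0 eps0 (ltr0Sn R 2))).
apply: filterS (Fq k) => z; rewrite -ball_normE/= => qkz.
rewrite -(subrK (q k) (up_class y)) -addrA.
rewrite (le_lt_trans (ler_normD _ _))// distrC.
rewrite (_ : eps = 2 * (eps / 3) + eps / 3); last first.
  by rewrite -[X in _ + X]mul1r -mulrDl natr1 mulrCA divff ?mulr1.
rewrite ler_ltD ?(lt_trans qkz)// (le_trans (qy k))// ler_wpM2l//; exact: ltW.
Qed.

HB.instance Definition _ := Uniform_isComplete.Build ultrapower up_complete.

End Ultrapower.
Arguments ulim_normP {R X} U x.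
Arguments ultrapower {R} X U.
Arguments up_class {R X} U x.

(* Main.v *)
Require Import Defs.
From HB Require Import structures.
From mathcomp Require Import all_boot all_order all_algebra.
From mathcomp Require Import all_classical all_reals all_analysis.
From mathcomp Require Import ring lra.

(**
One Banach space [X] serves all three parts.  It is the completion of an
increasing union of finite-dimensional spaces [E_k], realised on polynomials of
bounded degree.  Let [h_1, ..., h_M] be independent copies of a nonnegative
variable of mean one with [P(h > t) <= c / t] for a tiny [c] (a Bourgain-Rosenthal
type variable), and norm [E_k + E_k^M] by
  [ |(b, v)| = E |b + sum_i h_i v_i| + e * sum_i |v_i| ];
[E_(k+1)] is the l1-sum of this space with a line spanned by a new vector [u].

- Spreading: for [x, y] in [E_k] the vectors [y h_i] have norm about [|y|], satisfy
  [|x + y h_i| ~ |x| + |y|] because [h_i] lives on a small set, and average to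
  [y] when [M] is large.  This gives the Daugavet property of [X].
- Rigidity: the term [e * sum_i |v_i|] bounds [a = sum_i |v_i|] by the norm.
  Truncating [h_i] at [a / |v_i|] changes [b + sum_i h_i v_i] only with
  probability at most [c], and the truncated sum has variance of order
  [c a^2]; so up to small peaks the sum is a constant vector [Q(b, v)] of [E_k].
  Hence [Q] is almost linear and [|(b, v)|] is almost [|Q(b, v)|] plus a
  quantity that does not change when [b] is shifted by a vector of [E_k].

Composing the maps [Q] of all later stages and taking the coordinate along [u]
gives, for every [d > 0], an almost linear functional [f] with [f u = 1],
[|f p| <= (1 + d) |p|] and [|p - f(p) u| <= (1 + d) |p|].  Then [f] is at least
[-1/4 - d] on [l+(u, 1/4)], so combinations of [n] such vectors stay away
from [-u] once [n d] is small; and along an ultrafilter these functionals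
converge to a linear one, [f], on the ultrapower, with [|Id - f(.) u| <= 1 < 2].
*)

Set Implicit Arguments.
Unset Strict Implicit.
Unset Printing Implicit Defensive.

Import Order.TTheory GRing.Theory Num.Theory.
Import numFieldNormedType.Exports.

Local Open Scope classical_set_scope.
Local Open Scope ring_scope.

(** * Expectations over finite product spaces *)

Section Expectation.
Variable R : realType.
Implicit Types T : finType.

Definition expect T (w : T -> R) (F : T -> R) : R := \sum_t w t * F t.

Definition is_prob T (w : T -> R) : Prop :=
  (forall t, 0 <= w t) /\ \sum_t w t = 1.

Lemma eq_expect T (w F G : T -> R) : F =1 G -> expect w F = expect w G.
Proof. by move=> FG; apply: eq_bigr => t _; rewrite FG. Qed.

Lemma expectD T (w F G : T -> R) :
  expect w (fun t => F t + G t) = expect w F + expect w G.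
Proof. by rewrite /expect -big_split/=; apply: eq_bigr => t _; rewrite mulrDr. Qed.

Lemma expectZ T (w : T -> R) a F :
  expect w (fun t => a * F t) = a * expect w F.
Proof. by rewrite /expect mulr_sumr; apply: eq_bigr => t _; rewrite mulrCA. Qed.

Lemma expect_sum T (w : T -> R) (I : finType) (F : I -> T -> R) :
  expect w (fun t => \sum_i F i t) = \sum_i expect w (F i).
Proof.
by rewrite /expect exchange_big; apply: eq_bigr => t _; rewrite mulr_sumr.
Qed.

Lemma expect_cst T (w : T -> R) a : is_prob w -> expect w (fun=> a) = a.
Proof. by case=> _ w1; rewrite /expect -mulr_suml w1 mul1r. Qed.

Lemma expect_le T (w F G : T -> R) : is_prob w ->
  (forall t, F t <= G t) -> expect w F <= expect w G.
Proof. by case=> w0 _ FG; apply: ler_sum => t _; rewrite ler_wpM2l. Qed.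

Lemma expect_ge0 T (w F : T -> R) : is_prob w ->
  (forall t, 0 <= F t) -> 0 <= expect w F.
Proof. by case=> w0 _ F0; apply: sumr_ge0 => t _; rewrite mulr_ge0. Qed.

(** Jensen's inequality: the second moment of [Z] minus the square of the mean of [|Z|] is the
    variance of [|Z|], hence nonnegative. *)
Lemma expect_abs_le T (w Z : T -> R) (B : R) : is_prob w -> 0 <= B ->
  expect w (fun t => Z t ^+ 2) <= B ^+ 2 -> expect w (fun t => `|Z t|) <= B.
Proof.
move=> pw B0 ZB; set e := expect w _.
have e0 : 0 <= e by exact: expect_ge0.
rewrite -ler_sqr ?nnegrE//; apply: le_trans ZB; rewrite -subr_ge0.
have -> : expect w (fun t => Z t ^+ 2) - e ^+ 2
        = expect w (fun t => (`|Z t| - e) ^+ 2).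
  rewrite [RHS](@eq_expect _ w _ (fun t => Z t ^+ 2 + (- (2 * e) * `|Z t| + e ^+ 2))).
    by rewrite !expectD expectZ -/e expect_cst//; ring.
  move=> t; have -> : Z t ^+ 2 = `|Z t| ^+ 2 by rewrite real_normK ?num_real.
  by ring.
by apply: expect_ge0 => // t; exact: sqr_ge0.
Qed.

Section Product.
Variables (T : finType) (w : T -> R) (M : nat).
Hypothesis pw : is_prob w.

Definition prod_weight (o : {ffun 'I_M -> T}) : R := \prod_i w (o i).

Lemma expect_prod (G : 'I_M -> T -> R) :
  expect prod_weight (fun o => \prod_i G i (o i)) = \prod_i expect w (G i).
Proof.
rewrite /expect bigA_distr_bigA/=; apply: eq_bigr => o _.
by rewrite -big_split.
Qed.

Lemma prod_weight_prob : is_prob prod_weight.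
Proof.
split=> [f|]; first by apply: prodr_ge0 => i _; case: pw.
transitivity (\prod_(i < M) expect w (fun=> 1)).
  rewrite -expect_prod; apply: eq_bigr => o _; rewrite big1 ?mulr1//.
by rewrite big1// => i _; rewrite expect_cst.
Qed.

Lemma expect_prod1 i (G : T -> R) :
  expect prod_weight (fun o => G (o i)) = expect w G.
Proof.
have := expect_prod (fun k t => if k == i then G t else 1).
rewrite [RHS](bigD1 i)//= eqxx big1 ?mulr1 => [ <- |k /negPf ->]; last first.
  by rewrite expect_cst.
apply: eq_expect => o; rewrite (bigD1 i)//= eqxx big1 ?mulr1// => k /negPf ->//.
Qed.

Lemma expect_prod2 i j (G H : T -> R) : i != j ->
  expect prod_weight (fun o => G (o i) * H (o j)) = expect w G * expect w H.
Proof.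
move=> ij.
have := expect_prod (fun k t => if k == i then G t else if k == j then H t else 1).
rewrite [RHS](bigD1 i)//= (bigD1 j) 1?eq_sym//= eqxx [j == i]eq_sym (negPf ij) eqxx.
rewrite [X in _ * (_ * X)]big1 ?mulr1 => [ <- |k /andP[/negPf -> /negPf ->]]; last first.
  by rewrite expect_cst.
apply: eq_expect => o; rewrite (bigD1 i)//= (bigD1 j) 1?eq_sym//= eqxx.
rewrite [j == i]eq_sym (negPf ij) eqxx big1 ?mulr1// => k.
by move=> /andP[/negPf -> /negPf ->].
Qed.

(** Centred variables on different coordinates are independent, so the cross terms vanish. *)
Lemma expect_sqr_sum (a : 'I_M -> R) (X : 'I_M -> T -> R) :
  (forall i, expect w (X i) = 0) ->
  expect prod_weight (fun o => (\sum_i a i * X i (o i)) ^+ 2)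
  = \sum_i a i ^+ 2 * expect w (fun t => X i t ^+ 2).
Proof.
move=> X0.
rewrite (@eq_expect _ _ _
  (fun o : {ffun _} => \sum_i \sum_j (a i * a j) * (X i (o i) * X j (o j)))); last first.
  move=> o; rewrite expr2 mulr_suml; apply: eq_bigr => i _.
  by rewrite mulr_sumr; apply: eq_bigr => j _; ring.
rewrite expect_sum; apply: eq_bigr => i _; rewrite expect_sum (bigD1 i)//=.
rewrite expectZ big1 ?addr0 => [|j ji]; last first.
  by rewrite expectZ (@expect_prod2 _ _ (X i) (X j)) 1?eq_sym// !X0 !mulr0.
rewrite -expr2; congr (_ * _).
exact: (@expect_prod1 i (fun t => X i t * X i t)).
Qed.

Lemma expect_sqr_centered (X : T -> R) :
  expect w (fun t => (X t - expect w X) ^+ 2) <= expect w (fun t => X t ^+ 2).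
Proof.
rewrite (@eq_expect _ w _
  (fun t => X t ^+ 2 + (- (2 * expect w X) * X t + expect w X ^+ 2))); last first.
  by move=> t; ring.
by rewrite !expectD expectZ expect_cst//; have := sqr_ge0 (expect w X); lra.
Qed.

End Product.
End Expectation.

(** * Heavy-tailed variables of mean one with small weak L1-norm *)

Section HeavyTail.
Variable R : realType.

(* The mean is one although the weak L1-norm is at most [c]. *)
Record heavy_tailed (c : R) (T : finType) (w h : T -> R) : Prop := {
  ht_prob : is_prob w;
  ht_ge0 : forall t, 0 <= h t;
  ht_mean : expect w h = 1;
  ht_tail : forall x : R, 0 < x -> x * expect w (fun t => (x < h t)%R%:R) <= c;
  ht_trunc : forall x : R, 0 <= x ->
    expect w (fun t => (h t * (h t <= x)%R%:R) ^+ 2) <= c * x;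
  ht_supp : expect w (fun t => (h t != 0)%:R) <= c
}.

(** A geometric tail is at most twice its first term, which is below [1 / x]. The correction
    [- 2 ^- n] is the part of the series not yet summed and makes the induction close; the maximum
    with 0 covers the case where no power exceeds [x] yet. *)
Lemma geo_tail (x : R) n : 0 < x ->
  \sum_(j < n) 2 ^- j.+1 * (x < 2 ^+ j.+1)%R%:R <= Num.max 0 (2 / x - 2 ^- n).
Proof.
move=> x0; elim: n => [|n IH]; first by rewrite big_ord0 le_max lexx.
rewrite big_ord_recr/=; case: (ltP x (2 ^+ n.+1)) => xn; rewrite ?mulr0 ?addr0.
  rewrite mulr1 le_max; apply/orP; right; apply: le_trans (lerD IH (lexx _)) _.
  have e1 : (2 ^- n : R) = 2 * 2 ^- n.+1.
    by rewrite exprS invfM mulrA divff ?pnatr_eq0// mul1r.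
  have e2 : 2 * 2 ^- n.+1 <= 2 / x.
    by rewrite ler_pM2l// lef_pV2 ?posrE ?exprn_gt0// ltW.
  rewrite e1 max_r; last by rewrite subr_ge0.
  lra.
apply: le_trans IH _; rewrite ge_max le_max lexx/= le_max; apply/orP; right.
by rewrite lerD2l lerN2 lef_pV2 ?posrE ?exprn_gt0// ler_eXn2l ?ltr1n.
Qed.

(** The second bound carries the induction: if the next power is still at most [x], the earlier sum
    is at most that power, so the new sum is at most [2 * x]. *)
Lemma geo_trunc (x : R) n : 0 <= x ->
  \sum_(j < n) 2 ^+ j.+1 * (2 ^+ j.+1 <= x)%R%:R <= Num.min (2 * x) (2 * 2 ^+ n).
Proof.
move=> x0; elim: n => [|n IH].
  by rewrite big_ord0 le_min !mulr_ge0// exprn_ge0.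
rewrite big_ord_recr/=; move: IH; rewrite le_min => /andP[I1 I2].
rewrite le_min; case: (leP (2 ^+ n.+1) x) => xn; rewrite ?mulr0 ?addr0 ?mulr1.
  move: xn I1 I2; rewrite exprS; move: (\sum_(_ < n) _) (2 ^+ n) => s y xn I1 I2.
  by apply/andP; split; lra.
rewrite I1/= (le_trans I2)// exprS ler_pM2l// ler_peMl ?exprn_ge0//; lra.
Qed.

Lemma geo_sum n : \sum_(j < n) 2 ^- j.+1 = 1 - 2 ^- n :> R.
Proof.
elim: n => [|n IH]; first by rewrite big_ord0 expr0 invr1 subrr.
rewrite big_ord_recr/= IH.
have -> : (2 ^- n : R) = 2 * 2 ^- n.+1 by rewrite exprS invfM mulrA divff ?pnatr_eq0// mul1r.
by ring.
Qed.

(** [h] takes the value [2 ^ (j + 1)] with probability [2 ^ -(j + 1) / n] for [j < n], and 0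
    otherwise. Each level contributes [1 / n] to the mean, whereas the tail and the truncated second
    moment only see geometric sums, which gives the constant [2 / n <= c]. *)
Lemma heavy_tailed_exists (c : R) : 0 < c ->
  exists (T : finType) (w h : T -> R), heavy_tailed c w h.
Proof.
move=> c0; have c20 : 0 <= 2 / c by rewrite divr_ge0 // ltW.
have [n n0 cJ] : exists2 n, (0 < n)%N & 2 / c < n%:R.
  exists (Num.bound (2 / c)).+1 => //.
  by apply: lt_le_trans (archi_boundP c20) _; rewrite ler_nat.
have Jp : (0 : R) < n%:R by rewrite ltr0n.
have cJ' : n%:R^-1 * 2 <= c.
  by rewrite mulrC ler_pdivrMr// mulrC -ler_pdivrMr// ltW.
pose q (j : 'I_n) : R := n%:R^-1 * 2 ^- j.+1.
have q0 j : 0 <= q j by rewrite mulr_ge0 ?invr_ge0 ?exprn_ge0.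
have sq : \sum_j q j <= n%:R^-1.
  by rewrite -mulr_sumr geo_sum ger_pMr ?invr_gt0// lerBlDr lerDl invr_ge0 exprn_ge0.
have n1 : (n%:R^-1 : R) <= 1 by rewrite invf_le1// ler1n.
(* [None] carries the remaining mass; [h] vanishes there. *)
pose w (t : option 'I_n) := if t is Some j then q j else 1 - \sum_j q j.
pose h (t : option 'I_n) : R := if t is Some j then 2 ^+ j.+1 else 0.
have Ew F : F None = 0 -> expect w F = \sum_j q j * F (Some j).
  move=> F0; rewrite /expect (bigD1 None)//= F0 mulr0 add0r.
  rewrite (reindex_omap Some id) => [|[]]//=.
  by apply: eq_bigl => j; rewrite eqxx.
exists (option 'I_n), w, h; split.
- split=> [[j|]//=|]; first by rewrite subr_ge0 (le_trans sq).
  have -> : \sum_t w t = expect w (fun t => (t != None)%:R) + w None.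
    rewrite /expect (bigD1 None)//= [X in _ = X + _](bigD1 None)//=.
    rewrite mulr0 add0r addrC; congr (_ + _).
    by apply: eq_bigr => t ->; rewrite mulr1.
  by rewrite Ew//=; under eq_bigr do rewrite mulr1; rewrite addrC subrK.
- by case=> [j|]//=; exact: exprn_ge0.
- rewrite Ew//= (eq_bigr (fun=> n%:R^-1)) => [|j _]; last first.
    by rewrite /q mulfVK ?expf_neq0 ?pnatr_eq0.
  by rewrite sumr_const card_ord -[LHS]mulr_natr mulVf// gt_eqF.
- move=> x x0; rewrite Ew/=; last by rewrite ltNge ltW.
  rewrite (eq_bigr (fun j : 'I_n => n%:R^-1 * (2 ^- j.+1 * (x < 2 ^+ j.+1)%R%:R)))
    => [|j _]; last by rewrite mulrA.
  rewrite -mulr_sumr; apply: le_trans cJ'.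
  rewrite mulrCA ler_pM2l ?invr_gt0// mulrC -ler_pdivlMr//.
  apply: le_trans (geo_tail n x0) _; rewrite ge_max divr_ge0 ?(ltW x0)//=.
  by rewrite lerBlDr lerDl invr_ge0 exprn_ge0.
- move=> x x0; rewrite Ew/=; last by rewrite mul0r expr0n.
  rewrite (eq_bigr (fun j : 'I_n => n%:R^-1 * (2 ^+ j.+1 * (2 ^+ j.+1 <= x)%R%:R)))
    => [|j _]; last first.
    rewrite /q exprMn expr2; case: (_ <= x); last by rewrite expr0n/= !mulr0.
    rewrite expr1n !mulr1 -mulrA; congr (_ * _).
    by rewrite mulrA mulVf ?mul1r// expf_neq0// pnatr_eq0.
  rewrite -mulr_sumr; apply: le_trans (ler_wpM2r x0 cJ').
  rewrite -mulrA ler_pM2l ?invr_gt0//.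
  by have := geo_trunc n x0; rewrite le_min => /andP[].
- rewrite Ew/=; last by rewrite eqxx.
  apply: le_trans (le_trans (_ : _ <= \sum_j q j) sq) _.
    apply: ler_sum => j _; rewrite ger_pMr ?lern1 ?leq_b1//.
    by rewrite /q mulr_gt0 ?invr_gt0 ?exprn_gt0.
  by apply: le_trans cJ'; rewrite ler_peMr ?invr_ge0 ?ler1n// ltW.
Qed.

End HeavyTail.

(** * The norm with peaks *)

Section Seminorm.
Variables (R : realType) (V : lmodType R).

Definition seminorm (N : V -> R) : Prop :=
  (forall p q, N (p + q) <= N p + N q) /\ (forall a p, N (a *: p) = `|a| * N p).

Variable N : V -> R.
Hypothesis sN : seminorm N.

Lemma seminorm0 : N 0 = 0.
Proof. by rewrite -(scale0r (0 : V)) sN.2 normr0 mul0r. Qed.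

Lemma seminormN p : N (- p) = N p.
Proof. by rewrite -scaleN1r sN.2 normrN normr1 mul1r. Qed.

Lemma seminorm_ge0 p : 0 <= N p.
Proof.
by have := sN.1 p (- p); rewrite subrr seminorm0 seminormN; lra.
Qed.

Lemma seminormB p q : N (p - q) <= N p + N q.
Proof. by have := sN.1 p (- q); rewrite seminormN. Qed.

Lemma seminorm_subD p q : N p - N q <= N (p + q).
Proof. by have := seminormB (p + q) q; rewrite addrK; lra. Qed.

Lemma seminorm_sum (I : finType) (F : I -> V) : N (\sum_i F i) <= \sum_i N (F i).
Proof.
elim/big_ind2: _ => [|x1 x2 y1 y2 h1 h2|//]; first by rewrite seminorm0.
exact: le_trans (sN.1 _ _) (lerD h1 h2).
Qed.

End Seminorm.

Section ZmodIdentities.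
Variable V : zmodType.
Implicit Types a b c d s x y : V.

Lemma addr_split b c s x : b + x = b + c + (s - c) + (x - s).
Proof. by rewrite [X in _ = X + _]addrACA subrr addr0 -addrA (addrC s) subrK. Qed.

Lemma addr_cancel2 x y a b c : x + y + a - (x + b) - (y + c) = a - b - c.
Proof.
rewrite !opprD [x + y + a + _]addrACA [LHS]addrACA.
by rewrite [x + y - x]addrAC subrr add0r subrr add0r.
Qed.

Lemma addr_cancel3 a b c x y : a - b - c = x - b + (y - c) - (x + y - a).
Proof.
by rewrite addrACA opprB [x + y + _]addrC -[RHS]addrA [x + y + _]addrC subrK addrC addrA.
Qed.

End ZmodIdentities.

Section PeakNorm.
Variables (R : realType) (V : lmodType R) (N : V -> R).
Variables (T : finType) (w h : T -> R) (M : nat).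
Implicit Types (b : V) (v : 'I_M -> V) (o : {ffun 'I_M -> T}).

Definition total_norm v : R := \sum_i N (v i).

Definition peak_sum v o : V := \sum_i h (o i) *: v i.

Definition peak_norm (e : R) b v : R :=
  expect (prod_weight w (M := M)) (fun o => N (b + peak_sum v o)) + e * total_norm v.

(** Truncation of [h] at the level [total_norm v / N (v i)], written without division so that
    nothing is cut when [N (v i) = 0]. *)
Definition cut_value v i (t : T) : R := h t * (h t * N (v i) <= total_norm v)%R%:R.

Definition cut_sum v o : V := \sum_i cut_value v i (o i) *: v i.

Definition cut_mean v : V := \sum_i expect w (cut_value v i) *: v i.

Definition overflow v o : bool := [exists i, total_norm v < h (o i) * N (v i)].

Hypothesis sN : seminorm N.
Variable c : R.
Hypothesis ht : heavy_tailed c w h.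

Let pw := ht_prob ht.
Let pm : is_prob (prod_weight w (M := M)) := prod_weight_prob M pw.
Let E := expect (prod_weight w (M := M)).

Lemma total_norm_ge0 v : 0 <= total_norm v.
Proof. by apply: sumr_ge0 => i _; exact: seminorm_ge0. Qed.

Lemma cut_sumE v o : ~~ overflow v o -> cut_sum v o = peak_sum v o.
Proof.
move=> /existsPn H; apply: eq_bigr => i _; congr (_ *: _).
by rewrite /cut_value leNgt H mulr1.
Qed.

(** Union bound: by the weak L1 estimate the [i]-th event has probability at most
    [c * N (v i) / total_norm v], and these bounds add up to [c]. *)
Lemma overflow_small v : E (fun o => (overflow v o)%:R) <= c.
Proof.
have c0 : 0 <= c.
  by apply: le_trans (ht_supp ht); apply: expect_ge0 => // t; case: (_ != 0).
(* When the total norm is 0, every [N (v i)] is 0 and no overflow can occur. *)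
have [A0|A0] := ltP 0 (total_norm v); last first.
  have N0 i : N (v i) = 0.
    have /eqP : total_norm v = 0 by apply/eqP; rewrite eq_le A0 total_norm_ge0.
    rewrite psumr_eq0 => [/allP/(_ i (mem_index_enum _))/eqP//|k _].
    exact: seminorm_ge0.
  rewrite (_ : E _ = 0)//; apply: big1 => o _.
  rewrite (_ : overflow v o = false) ?mulr0//; apply/negbTE/existsPn => i.
  by rewrite N0 mulr0 -leNgt total_norm_ge0.
apply: (@le_trans _ _ (E (fun o => \sum_i (total_norm v < h (o i) * N (v i))%R%:R))).
  apply: expect_le => // o.
  case: (boolP (overflow v o)) => [/existsP[i oi]|_]; last exact: sumr_ge0.
  by rewrite (bigD1 i)//= oi lerDl sumr_ge0.
rewrite /E expect_sum.
have -> : c = \sum_i c * (N (v i) / total_norm v).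
  by rewrite -mulr_sumr -mulr_suml mulfV ?mulr1// gt_eqF.
apply: ler_sum => i _.
rewrite (expect_prod1 pw i (fun t => (total_norm v < h t * N (v i))%R%:R)).
have := seminorm_ge0 sN (v i); rewrite le_eqVlt => /orP[/eqP <-|Ni].
  rewrite mul0r mulr0 /expect big1// => t _.
  by rewrite mulr0 ltNge total_norm_ge0 mulr0.
have x0 : 0 < total_norm v / N (v i) by exact: divr_gt0.
rewrite [leRHS]mulrC -invf_div ler_pdivlMl//; apply: le_trans (ht_tail ht x0).
rewrite ler_pM2l// le_eqVlt; apply/orP; left; apply/eqP.
by apply: eq_expect => t; rewrite ltr_pdivrMr.
Qed.

(** The second moment truncated at [x = total_norm v / N (v i)] is at most [c * x], and one factor
    [N (v i)] cancels. The bound is linear in [N (v i)], so it sums over [i] to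
    [c * total_norm v ^+ 2]. *)
Lemma cut_var v i :
  N (v i) ^+ 2 * expect w (fun t => cut_value v i t ^+ 2) <= c * total_norm v * N (v i).
Proof.
have := seminorm_ge0 sN (v i); rewrite le_eqVlt => /orP[/eqP <-|Ni].
  by rewrite expr0n mul0r mulr0.
have x0 : 0 <= total_norm v / N (v i) by rewrite divr_ge0 ?total_norm_ge0// ltW.
have := ht_trunc ht x0.
rewrite (@eq_expect _ _ w _ (fun t => cut_value v i t ^+ 2)) => [|t]; last first.
  by rewrite /cut_value ler_pdivlMr.
rewrite mulrA ler_pdivlMr// => H.
by rewrite expr2 -mulrA [leRHS]mulrC ler_pM2l// mulrC.
Qed.

(* Only finitely many coordinates [l j] control [N], hence the scalar variance
   bound gives a bound in norm. *)
Lemma cut_dev (m : nat) (l : 'I_m -> V -> R) (K s : R) v :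
  0 <= K -> 0 <= s -> c <= s ^+ 2 ->
  (forall j (a : 'I_M -> R) u, l j (\sum_i a i *: u i) = \sum_i a i * l j (u i)) ->
  (forall p, N p <= K * \sum_j `|l j p|) -> (forall j p, `|l j p| <= K * N p) ->
  E (fun o => N (cut_sum v o - cut_mean v)) <= K * (K * s * m%:R) * total_norm v.
Proof.
move=> K0 s0 cs lin NK lK.
have A0 := total_norm_ge0 v.
pose X i t := cut_value v i t - expect w (cut_value v i).
have dE o : cut_sum v o - cut_mean v = \sum_i X i (o i) *: v i.
  by rewrite /cut_sum /cut_mean -sumrB; apply: eq_bigr => i _; rewrite scalerBl.
apply: (@le_trans _ _ (E (fun o => K * \sum_j `|\sum_i l j (v i) * X i (o i)|))).
  apply: expect_le => // o; rewrite dE; apply: le_trans (NK _) _.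
  rewrite ler_wpM2l//; apply: ler_sum => j _; rewrite lin le_eqVlt.
  by apply/orP; left; apply/eqP; congr `|_|; apply: eq_bigr => i _; rewrite mulrC.
rewrite /E expectZ expect_sum -mulrA ler_wpM2l//.
have -> : K * s * m%:R * total_norm v = \sum_(j < m) K * s * total_norm v.
  by rewrite sumr_const card_ord -mulr_natr; ring.
apply: ler_sum => j _; apply: expect_abs_le => //; first by rewrite !mulr_ge0.
rewrite (@expect_sqr_sum _ _ _ _ pw (fun i => l j (v i)) X) => [|i]; last first.
  by rewrite /X expectD expect_cst// subrr.
apply: (@le_trans _ _ (\sum_i K ^+ 2 * (c * total_norm v * N (v i)))).
  apply: ler_sum => i _; apply: le_trans (ler_wpM2l (sqr_ge0 K) (cut_var v i)).
  rewrite mulrA -exprMn; apply: ler_pM; first exact: sqr_ge0.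
  - by apply: expect_ge0 => // t; exact: sqr_ge0.
  - by rewrite -[leLHS]real_normK ?num_real// lerXn2r ?nnegrE// mulr_ge0 ?seminorm_ge0.
  - exact: expect_sqr_centered.
rewrite -mulr_sumr -mulr_sumr -/(total_norm v) !exprMn.
rewrite -[leRHS]mulrA ler_wpM2l ?sqr_ge0//.
by rewrite -mulrA -expr2 ler_wpM2r ?sqr_ge0.
Qed.

Lemma peak_normD e b v b' v' : 0 <= e ->
  peak_norm e (b + b') (fun i => v i + v' i) <= peak_norm e b v + peak_norm e b' v'.
Proof.
move=> e0; rewrite /peak_norm.
have tD : total_norm (fun i => v i + v' i) <= total_norm v + total_norm v'.
  by rewrite /total_norm -big_split/=; apply: ler_sum => i _; exact: sN.1.
have := ler_wpM2l e0 tD; rewrite mulrDr.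
suff : E (fun o => N (b + b' + peak_sum (fun i => v i + v' i) o)) <=
  E (fun o => N (b + peak_sum v o)) + E (fun o => N (b' + peak_sum v' o)).
  by rewrite /E; lra.
rewrite /E -expectD; apply: expect_le => // o.
suff -> : peak_sum (fun i => v i + v' i) o = peak_sum v o + peak_sum v' o.
  by rewrite addrACA sN.1.
by rewrite /peak_sum -big_split/=; apply: eq_bigr => i _; rewrite scalerDr.
Qed.

Lemma total_normZ a v : total_norm (fun i => a *: v i) = `|a| * total_norm v.
Proof. by rewrite /total_norm mulr_sumr; apply: eq_bigr => i _; rewrite sN.2. Qed.

Lemma peak_sumZ a v o : peak_sum (fun i => a *: v i) o = a *: peak_sum v o.
Proof.
rewrite /peak_sum scaler_sumr; apply: eq_bigr => i _.
by rewrite !scalerA mulrC.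
Qed.

Lemma peak_normZ e a b v :
  peak_norm e (a *: b) (fun i => a *: v i) = `|a| * peak_norm e b v.
Proof.
rewrite /peak_norm mulrDr total_normZ mulrCA; congr (_ + _).
by rewrite -expectZ; apply: eq_expect => o; rewrite peak_sumZ -scalerDr sN.2.
Qed.

Lemma peak_norm0 e b : peak_norm e b (fun=> 0) = N b.
Proof.
rewrite /peak_norm /total_norm big1 => [|i _]; last exact: seminorm0.
rewrite mulr0 addr0 -[RHS](expect_cst _ pm); apply: eq_expect => o.
by rewrite /peak_sum big1 ?addr0// => i _; rewrite scaler0.
Qed.

(** The summand weighted by [e] is in the norm for the sake of this estimate: it turns errors
    proportional to [total_norm] into errors proportional to the norm. *)
Lemma peak_norm_total e b v : e * total_norm v <= peak_norm e b v.
Proof.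
by rewrite /peak_norm lerDr; apply: expect_ge0 => // o; exact: seminorm_ge0.
Qed.

Lemma expect_peak_sum v : E (fun o => N (peak_sum v o)) <= total_norm v.
Proof.
have -> : total_norm v = E (fun o => \sum_i h (o i) * N (v i)).
  rewrite /E expect_sum; apply: eq_bigr => i _.
  rewrite (expect_prod1 pw i (fun t => h t * N (v i))) -[LHS]mulr1 -(ht_mean ht).
  by rewrite -expectZ; apply: eq_expect => t; rewrite mulrC.
apply: expect_le => // o; apply: le_trans (seminorm_sum sN _) _.
by apply: ler_sum => i _; rewrite sN.2 ger0_norm// (ht_ge0 ht).
Qed.

Lemma peak_norm_le e b v : peak_norm e b v <= N b + (1 + e) * total_norm v.
Proof.
have := expect_peak_sum v.
suff : E (fun o => N (b + peak_sum v o)) <= N b + E (fun o => N (peak_sum v o)).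
  by rewrite /peak_norm /E mulrDl mul1r; lra.
rewrite -[X in X + _](expect_cst (N b) pm) -expectD; apply: expect_le => // o.
exact: sN.1.
Qed.

Lemma peak_norm_ge e b v : 0 <= e -> N b <= peak_norm e b v + total_norm v.
Proof.
move=> e0; have := expect_peak_sum v.
have : 0 <= e * total_norm v by rewrite mulr_ge0// total_norm_ge0.
suff : N b <= E (fun o => N (b + peak_sum v o)) + E (fun o => N (peak_sum v o)).
  by rewrite /peak_norm /E; lra.
rewrite -[X in X <= _](expect_cst (N b) pm) -expectD; apply: expect_le => // o.
have := seminorm_subD sN b (peak_sum v o); lra.
Qed.

(** * The almost linear projection onto the previous stage *)

Section Projection.
Variables (e k : R).
Hypotheses (e0 : 0 <= e) (k0 : 0 <= k).
Hypothesis dev : forall v, E (fun o => N (cut_sum v o - cut_mean v)) <= k * total_norm v.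

(** The vector [Q(b, v)] of the overview: the nearly constant value of [b + peak_sum v] off the
    overflow event. *)
Definition peak_proj b v : V := b + cut_mean v.

(** The contribution of what exceeds the truncation levels, together with the [e]-term. It does not
    involve [b], hence is common to all shifts of [b]. *)
Definition peak_rest v : R :=
  E (fun o => N (peak_sum v o - cut_sum v o)) + e * total_norm v.

Lemma peak_norm_upper b v :
  peak_norm e b v <= N (peak_proj b v) + k * total_norm v + peak_rest v.
Proof.
rewrite /peak_norm /peak_rest /peak_proj.
suff : E (fun o => N (b + peak_sum v o)) <= N (b + cut_mean v)
    + E (fun o => N (cut_sum v o - cut_mean v))
    + E (fun o => N (peak_sum v o - cut_sum v o)).
  by have := dev v; rewrite /E; lra.
rewrite -[X in _ <= X + _ + _](expect_cst _ pm) -!expectD.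
apply: expect_le => // o.
rewrite (_ : b + peak_sum v o = b + cut_mean v + (cut_sum v o - cut_mean v)
   + (peak_sum v o - cut_sum v o)); last first.
  exact: addr_split.
by apply: le_trans (sN.1 _ _) _; rewrite lerD2r sN.1.
Qed.

(* Outside the overflow event the peaks vanish, so there the norms of the
   projection and of the peaks add up. *)
Lemma peak_norm_lower b v :
  (1 - 2 * c) * N (peak_proj b v) + peak_rest v - k * total_norm v <= peak_norm e b v.
Proof.
rewrite /peak_norm /peak_rest /peak_proj; set n := N _.
have n0 : 0 <= n by exact: seminorm_ge0.
have := ler_wpM2l n0 (overflow_small v); rewrite -expectZ => H.
suff : n + E (fun o => N (peak_sum v o - cut_sum v o)) <=
   E (fun o => N (b + peak_sum v o)) + 2 * E (fun o => n * (overflow v o)%:R)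
    + E (fun o => N (cut_sum v o - cut_mean v)).
  by have := dev v; rewrite /E; lra.
rewrite -[X in X + _ <= _](expect_cst n pm) -expectZ -!expectD.
apply: expect_le => // o; set P := peak_sum v o - cut_sum v o.
have e1 : b + peak_sum v o = (b + cut_mean v + P) + (cut_sum v o - cut_mean v).
  by rewrite [RHS]addrAC; exact: addr_split.
rewrite e1.
have := seminorm_subD sN (b + cut_mean v + P) (cut_sum v o - cut_mean v).
case: (boolP (overflow v o)) => [_|/cut_sumE ov]; last first.
  by rewrite /P ov subrr addr0 seminorm0// -/n mulr0; lra.
have := seminorm_subD sN P (b + cut_mean v); rewrite [P + _]addrC -/n mulr1; lra.
Qed.

Lemma peak_proj_le b v :
  (1 - 2 * c) * N (peak_proj b v) <= peak_norm e b v + k * total_norm v.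
Proof.
have := peak_norm_lower b v; suff : 0 <= peak_rest v by lra.
rewrite addr_ge0 ?mulr_ge0 ?total_norm_ge0//.
by apply: expect_ge0 => // o; exact: seminorm_ge0.
Qed.

(** The upper estimate at [b + u] and the lower estimate at [b] contain the same [peak_rest v],
    which cancels. *)
Lemma peak_norm_shift b u v : peak_norm e (b + u) v <= peak_norm e b v
  + N (peak_proj b v + u) - N (peak_proj b v)
  + 2 * c * N (peak_proj b v) + 2 * k * total_norm v.
Proof.
have := peak_norm_lower b v; have := peak_norm_upper (b + u) v.
have -> : peak_proj (b + u) v = peak_proj b v + u by rewrite /peak_proj addrAC.
lra.
Qed.

(** Untruncated sums are linear in [v]. Off three overflow events, each of probability at most [c],
    the cut sums agree with them, so the defect is a combination of the deviations of three cut sums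
    from their means. *)
Lemma peak_proj_almost_linear a b v b' v' :
  (1 - 3 * c) * N (peak_proj (a *: b + b') (fun i => a *: v i + v' i)
     - a *: peak_proj b v - peak_proj b' v')
  <= 2 * k * (`|a| * total_norm v + total_norm v').
Proof.
set v'' := fun i => a *: v i + v' i; set D := _ - _ - _.
have DE : D = cut_mean v'' - a *: cut_mean v - cut_mean v'.
  by rewrite /D /peak_proj scalerDr; exact: addr_cancel2.
have tD : total_norm v'' <= `|a| * total_norm v + total_norm v'.
  rewrite -total_normZ /total_norm -big_split/=; apply: ler_sum => i _; exact: sN.1.
have n0 : 0 <= N D by exact: seminorm_ge0.
have dev' := dev v'; have dev'' := dev v''.
have devv := ler_wpM2l (normr_ge0 a) (dev v).
have o1 := ler_wpM2l n0 (overflow_small v).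
have o2 := ler_wpM2l n0 (overflow_small v').
have o3 := ler_wpM2l n0 (overflow_small v'').
(* [N D] does not depend on [o]. It is bounded pointwise by overflow indicators plus deviations;
   averaging the indicators leaves [3 * c * N D], which moves to the left-hand side. *)
have : N D <= N D * E (fun o => (overflow v o)%:R) + N D * E (fun o => (overflow v' o)%:R)
  + N D * E (fun o => (overflow v'' o)%:R)
  + (E (fun o => N (cut_sum v'' o - cut_mean v''))
  + `|a| * E (fun o => N (cut_sum v o - cut_mean v))
  + E (fun o => N (cut_sum v' o - cut_mean v'))).
  rewrite -[X in X <= _](expect_cst (N D) pm) -!expectZ -!expectD.
  apply: expect_le => // o.
  have s1 := seminorm_ge0 sN (cut_sum v'' o - cut_mean v'').
  have s2 := seminorm_ge0 sN (cut_sum v o - cut_mean v).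
  have s3 := seminorm_ge0 sN (cut_sum v' o - cut_mean v').
  have s4 := mulr_ge0 (normr_ge0 a) s2.
  have p1 : 0 <= N D * (overflow v o)%:R by rewrite mulr_ge0.
  have p2 : 0 <= N D * (overflow v' o)%:R by rewrite mulr_ge0.
  have p3 : 0 <= N D * (overflow v'' o)%:R by rewrite mulr_ge0.
  case: (boolP (overflow v o)) p1 => [_|/cut_sumE g1 p1]; first by rewrite mulr1; lra.
  case: (boolP (overflow v' o)) p2 => [_|/cut_sumE g2 p2]; first by rewrite mulr1; lra.
  case: (boolP (overflow v'' o)) p3 => [_|/cut_sumE g3 p3]; first by rewrite mulr1; lra.
  have : D = a *: (cut_sum v o - cut_mean v) + (cut_sum v' o - cut_mean v')
     - (cut_sum v'' o - cut_mean v'').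
    have -> : cut_sum v'' o = a *: cut_sum v o + cut_sum v' o.
      rewrite g1 g2 g3 -peak_sumZ /peak_sum -big_split/=.
      by apply: eq_bigr => i _; rewrite scalerDr.
    by rewrite DE scalerBr; exact: addr_cancel3.
  move=> ->; have := seminormB sN (a *: (cut_sum v o - cut_mean v) + (cut_sum v' o - cut_mean v'))
     (cut_sum v'' o - cut_mean v'').
  have := sN.1 (a *: (cut_sum v o - cut_mean v)) (cut_sum v' o - cut_mean v').
  by rewrite sN.2 !mulr0; lra.
rewrite -/E in o1 o2 o3 dev' dev'' devv *.
have : k * total_norm v'' <= k * (`|a| * total_norm v + total_norm v').
  by rewrite ler_wpM2l.
lra.
Qed.

End Projection.
End PeakNorm.

(** * Stages *)

Section SinglePeaks.
Variables (R : realType) (V : lmodType R) (N : V -> R).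
Variables (T : finType) (w h : T -> R) (M : nat) (c e : R).
Hypotheses (sN : seminorm N) (ht : heavy_tailed c w h) (e0 : 0 <= e).

Let pw := ht_prob ht.
Let pm : is_prob (prod_weight w (M := M)) := prod_weight_prob M pw.

Definition single_peak (i : 'I_M) (y : V) (k : 'I_M) : V := if k == i then y else 0.

Lemma total_norm_single i y : total_norm N (single_peak i y) = N y.
Proof.
rewrite /total_norm (bigD1 i)//= /single_peak eqxx big1 ?addr0// => k /negPf ->.
exact: seminorm0.
Qed.

Lemma peak_sum_single i y o : peak_sum h (single_peak i y) o = h (o i) *: y.
Proof.
rewrite /peak_sum (bigD1 i)//= /single_peak eqxx big1 ?addr0// => k /negPf ->.
by rewrite scaler0.
Qed.

(** Where [h] vanishes the integrand is [N x]; elsewhere it is at least [h t * N y - N x]. Since [h]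
    has mean one, the only loss is [2 * N x] on an event of probability at most [c]. *)
Lemma peak_norm_single_ge x y i :
  N x + N y - 2 * c * N x <= peak_norm N w h e x (single_peak i y).
Proof.
rewrite /peak_norm total_norm_single.
under eq_expect do rewrite peak_sum_single.
rewrite (expect_prod1 pw i (fun t => N (x + h t *: y))).
have := ler_wpM2l (seminorm_ge0 sN x) (ht_supp ht); rewrite -expectZ.
have : 0 <= e * N y by rewrite mulr_ge0 ?seminorm_ge0.
suff : N x + N y <= expect w (fun t => N (x + h t *: y))
    + 2 * expect w (fun t => N x * (h t != 0)%:R) by lra.
have -> : N x + N y = expect w (fun t => N x + N y * h t).
  by rewrite expectD expect_cst// expectZ (ht_mean ht) mulr1.
rewrite -expectZ -expectD; apply: expect_le => // t.
have [->|h0] := eqVneq (h t) 0; first by rewrite scale0r addr0 /= !mulr0 !addr0.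
have := seminorm_subD sN (h t *: y) x; rewrite addrC sN.2 ger0_norm ?(ht_ge0 ht)//.
rewrite [h t *: y + x]addrC /= mulr1; lra.
Qed.

(** Mean-square law of large numbers: the vector inside the expectation is [y] times the deviation
    from 1 of the average of [M] independent copies of [h]. *)
Lemma peak_norm_mean_le y (d : R) : (0 < M)%N -> 0 <= d ->
  expect w (fun t => h t ^+ 2) <= d ^+ 2 * M%:R ->
  peak_norm N w h e (- y) (fun _ : 'I_M => M%:R^-1 *: y) <= (d + e) * N y.
Proof.
move=> M0 d0 hM; have Mn : (M%:R : R) != 0 by rewrite pnatr_eq0 -lt0n.
have Mp : (0 : R) < M%:R by rewrite ltr0n.
rewrite /peak_norm.
have -> : total_norm N (fun _ : 'I_M => M%:R^-1 *: y) = N y.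
  rewrite /total_norm sumr_const card_ord sN.2 ger0_norm ?invr_ge0// -[LHS]mulr_natr mulrAC.
  by rewrite mulVf ?mul1r.
rewrite mulrDl lerD2r.
pose X (t : T) := h t - expect w h.
rewrite (@eq_expect _ _ _ _ (fun o : {ffun 'I_M -> T} =>
    N y * `|\sum_i M%:R^-1 * X (o i)|)) => [|o]; last first.
  rewrite /peak_sum -scaler_suml scalerA -scaleN1r -scalerDl sN.2 mulrC.
  congr (_ * `|_|); rewrite -mulr_sumr /X sumrB (ht_mean ht) sumr_const card_ord.
  by rewrite mulrBr mulVf// mulrC addrC.
rewrite expectZ mulrC ler_wpM2r ?seminorm_ge0//.
apply: expect_abs_le => //.
rewrite (@expect_sqr_sum _ _ _ _ pw (fun=> M%:R^-1) (fun=> X)) => [|i]; last first.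
  by rewrite /X expectD expect_cst// subrr.
rewrite sumr_const card_ord -[leLHS]mulr_natr mulrAC exprVn.
have -> : (M%:R ^- 2 * M%:R : R) = M%:R^-1 by field.
rewrite ler_pdivrMl// mulrC; apply: le_trans hM; exact: expect_sqr_centered.
Qed.

End SinglePeaks.

(** * Stages on polynomials of bounded degree, and how consecutive stages are related *)

Section Stage.
Variable R : realType.
Implicit Types (m n M : nat) (p q x y : {poly R}) (N : {poly R} -> R).

(* A stage is a norm on the polynomials of degree at most [m] for which the line
   spanned by ['X^m] is an l1-summand. *)
Record stage m N : Prop := {
  st_seminorm : seminorm N;
  st_equiv : exists2 K : R, 0 <= K &
    (forall p, N p <= K * \sum_(j < m.+1) `|p`_j|) /\
    (forall (j : 'I_m.+1) p, `|p`_j| <= K * N p);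
  st_summand : forall p, N p = N (p - p`_m *: 'X^m) + `|p`_m|
}.

(* [Q] is not linear: it truncates at levels that depend on its argument. *)
Record almost_projection (d : R) m N N' (Q : {poly R} -> {poly R}) : Prop := {
  ap_size : forall p, (size (Q p) <= m.+1)%N;
  ap_id : forall p, (size p <= m.+1)%N -> Q p = p;
  ap_le : forall p, N (Q p) <= (1 + d) * N' p;
  ap_linear : forall a p q,
    N (Q (a *: p + q) - a *: Q p - Q q) <= d * (`|a| * N' p + N' q);
  ap_shift : forall p q, (size q <= m.+1)%N ->
    N' (p + q) <= N' p + N (Q p + q) - N (Q p) + d * (N' p + N q)
}.

(** Quantitative germ of the Daugavet property; the [z i] will be the vectors [y h_i] of the
    overview. *)
Definition spreads (d : R) m N m' N' : Prop :=
  forall x y, (size x <= m.+1)%N -> (size y <= m.+1)%N ->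
  exists M (z : 'I_M -> {poly R}), (0 < M)%N /\
   [/\ forall i, (size (z i) <= m'.+1)%N,
       forall i, N' (z i) <= (1 + d) * N y,
       forall i, (1 - d) * (N x + N y) <= N' (x + z i)
     & N' (M%:R^-1 *: (\sum_i z i) - y) <= d * N y].

Record refines (d : R) m N m' N' : Prop := {
  rf_lt : (m < m')%N;
  rf_eq : forall p, (size p <= m.+1)%N -> N' p = N p;
  rf_spreads : spreads d m N m' N';
  rf_proj : exists Q, almost_projection d m N N' Q
}.

(** Encoding of the next stage: with [n = m.+1], block 0 holds [b], block [i + 1] holds [v i], and
    the coefficient of degree [M.+1 * n] is the coordinate along the new vector [u]. *)
Definition block n (i : nat) p : {poly R} := take_poly n (drop_poly (i * n) p).

Lemma coef_block n i p j : (block n i p)`_j = if (j < n)%N then p`_(j + i * n) else 0.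
Proof. by rewrite coef_take_poly coef_drop_poly. Qed.

Lemma size_block n i p : (size (block n i p) <= n)%N.
Proof. exact: size_take_poly. Qed.

Lemma blockD n i p q : block n i (p + q) = block n i p + block n i q.
Proof. by rewrite /block drop_polyD take_polyD. Qed.

Lemma blockZ n i a p : block n i (a *: p) = a *: block n i p.
Proof. by rewrite /block drop_polyZ take_polyZ. Qed.

Lemma block0_id n p : (size p <= n)%N -> block n 0 p = p.
Proof. by move=> pn; rewrite /block mul0n drop_poly0l take_poly_id. Qed.

Lemma blockS_small n i p : (size p <= n)%N -> block n i.+1 p = 0.
Proof.
move=> pn; rewrite /block drop_poly_eq0 ?take_poly0r//.
by rewrite (leq_trans pn)// mulSn leq_addr.
Qed.

Lemma block_shift n i k y : (size y <= n)%N ->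
  block n k (y * 'X^(i * n)) = if k == i then y else 0.
Proof.
move=> yn; apply/polyP => j; rewrite coef_block coefMXn.
have y0 l : (n <= l)%N -> y`_l = 0.
  by move=> nl; rewrite nth_default// (leq_trans yn).
have [->|ki] := eqVneq k i.
  case: ifP => [jn|/negbT]; first by rewrite ltnNge leq_addl/= addnK.
  by rewrite -leqNgt => /y0.
rewrite coef0; case: ifP => // jn; case: ifP => // /negbT; rewrite -leqNgt => ij.
apply: y0; have {}ki : (i < k)%N.
  rewrite ltn_neqAle eq_sym ki leqNgt; apply/negP => lki.
  move: ij; rewrite leqNgt => /negP; apply.
  by rewrite (@leq_trans (k.+1 * n))%N ?leq_mul2r ?lki ?orbT// mulSn ltn_add2r.
rewrite -addnBA ?leq_mul2r ?(ltnW ki) ?orbT// -mulnBl.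
by rewrite (leq_trans _ (leq_addl _ _))// leq_pmull// subn_gt0.
Qed.

(** * Construction of the next stage *)

Section Step.
Variables (m : nat) (N : {poly R} -> R) (K : R).
Hypotheses (sN : seminorm N) (K0 : 0 <= K).
Hypothesis NK : forall p, N p <= K * \sum_(j < m.+1) `|p`_j|.
Hypothesis KN : forall (j : 'I_m.+1) p, `|p`_j| <= K * N p.
Variables (T : finType) (w h : T -> R) (c e : R) (M : nat).
Hypotheses (ht : heavy_tailed c w h) (e0 : 0 < e).

Let n := m.+1.
Let m' := (M.+1 * n)%N.
Let ge0e : 0 <= e := ltW e0.

Definition tail_blocks p (i : 'I_M) : {poly R} := block n i.+1 p.

Definition peak_part p : R := peak_norm N w h e (block n 0 p) (tail_blocks p).

Definition step_norm p : R := peak_part p + `|p`_m'|.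

Lemma tail_blocksD p q : tail_blocks (p + q) = (fun i => tail_blocks p i + tail_blocks q i).
Proof. by apply/funext => i; exact: blockD. Qed.

Lemma tail_blocksZ a p : tail_blocks (a *: p) = (fun i => a *: tail_blocks p i).
Proof. by apply/funext => i; exact: blockZ. Qed.

Lemma tail_blocks_small p : (size p <= n)%N -> tail_blocks p = (fun=> 0).
Proof. by move=> pn; apply/funext => i; exact: blockS_small. Qed.

Lemma peak_part_seminorm : seminorm peak_part.
Proof.
split=> [p q|a p]; rewrite /peak_part.
  by rewrite blockD tail_blocksD; apply: (peak_normD sN ht).
by rewrite blockZ tail_blocksZ; apply: (peak_normZ _ _ sN).
Qed.

Lemma total_norm_tail p : total_norm N (tail_blocks p) <= peak_part p / e.
Proof. by rewrite ler_pdivlMr// mulrC; exact: (peak_norm_total sN ht). Qed.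

Lemma block_norm_le i p : (i <= M)%N -> N (block n i p) <= (1 + e^-1) * peak_part p.
Proof.
have tp := total_norm_tail p.
have pp : 0 <= peak_part p by exact: seminorm_ge0 peak_part_seminorm _.
case: i => [_|i iM].
  have := peak_norm_ge sN ht (block n 0 p) (tail_blocks p) ge0e.
  by rewrite -/(peak_part p); lra.
have -> : block n i.+1 p = tail_blocks p (Ordinal iM) by [].
have : N (tail_blocks p (Ordinal iM)) <= total_norm N (tail_blocks p).
  rewrite /total_norm (bigD1 (Ordinal iM))//= lerDl sumr_ge0// => k _.
  exact: seminorm_ge0.
lra.
Qed.

(** The comparison with coefficients is inherited block by block: each degree below [m'] lies in one
    block, and the norm of a block is controlled by [peak_part] with the factor [1 + e^-1]. *)
Lemma peak_part_equiv : exists2 K' : R, 0 <= K' &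
  (forall p, peak_part p <= K' * \sum_(j < m') `|p`_j|) /\
  (forall (j : 'I_m') p, `|p`_j| <= K' * peak_part p).
Proof.
exists (K * (1 + e^-1) + (1 + (1 + e) * M%:R) * (K * n%:R)).
  by rewrite addr_ge0 ?mulr_ge0 ?addr_ge0 ?invr_ge0 ?mulr_ge0 ?addr_ge0.
have ei0 : 0 <= e^-1 by rewrite invr_ge0.
split=> [p|j p].
  set s := \sum_(j < _) _.
  have s0 : 0 <= s by exact: sumr_ge0.
  have ps l : (l < m')%N -> `|p`_l| <= s.
    by move=> lm; rewrite /s (bigD1 (Ordinal lm))//= lerDl sumr_ge0.
  have bs i : (i <= M)%N -> N (block n i p) <= K * n%:R * s.
    move=> iM; apply: le_trans (NK _) _; rewrite -mulrA ler_wpM2l//.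
    have -> : n%:R * s = \sum_(j < n) s by rewrite sumr_const card_ord mulr_natl.
    apply: ler_sum => j _; rewrite coef_block ltn_ord ps// /m' mulSn.
    by rewrite -addSn leq_add// leq_mul2r iM orbT.
  have : total_norm N (tail_blocks p) <= M%:R * (K * n%:R * s).
    rewrite mulr_natl -[M in X in _ <= X]card_ord -sumr_const; apply: ler_sum => i _.
    exact: bs.
  move=> /(ler_wpM2l (addr_ge0 ler01 ge0e)) tl.
  apply: le_trans (peak_norm_le sN ht _ _ _) _.
  have := bs 0%N (leq0n M); have : 0 <= K * (1 + e^-1) * s.
    by rewrite !mulr_ge0// addr_ge0.
  lra.
have pp : 0 <= peak_part p by exact: seminorm_ge0 peak_part_seminorm _.
have jM : (j %/ n <= M)%N by rewrite -ltnS ltn_divLR// ltn_ord.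
have -> : p`_j = (block n (j %/ n) p)`_(j %% n).
  by rewrite coef_block ltn_mod/= addnC -divn_eq.
have := KN (Ordinal (ltn_pmod j (ltn0Sn m))) (block n (j %/ n) p) => /=.
move=> /le_trans; apply; rewrite mulrDl -[leLHS]addr0 lerD//.
  by rewrite -mulrA ler_wpM2l// block_norm_le.
by rewrite !mulr_ge0// ?addr_ge0// mulr_ge0// addr_ge0.
Qed.

Lemma peak_part_high : peak_part 'X^m' = 0.
Proof.
have [K' _ [H _]] := peak_part_equiv.
apply/eqP; rewrite eq_le (seminorm_ge0 peak_part_seminorm) andbT.
apply: le_trans (H _) _; rewrite big1 ?mulr0// => j _.
by rewrite coefXn ltn_eqF ?normr0.
Qed.

Lemma step_stage : stage m' step_norm.
Proof.
have sP := peak_part_seminorm.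
split.
- split=> [p q|a p]; rewrite /step_norm.
    by rewrite coefD; have := sP.1 p q; have := ler_normD p`_m' q`_m'; lra.
  by rewrite [RHS]mulrDr coefZ normrM sP.2.
- have [K' K'0 [H1 H2]] := peak_part_equiv.
  exists (K' + 1); first by rewrite addr_ge0.
  split=> [p|j p]; rewrite /step_norm.
    rewrite big_ord_recr/=; have := H1 p.
    have : 0 <= \sum_(j < m') `|p`_j| by exact: sumr_ge0.
    have : 0 <= K' * `|p`_m'| by rewrite mulr_ge0.
    lra.
  have pp : 0 <= peak_part p by exact: seminorm_ge0 sP _.
  have K1 : 0 <= K' * `|p`_m'| by rewrite mulr_ge0.
  have := ltn_ord j; rewrite ltnS leq_eqVlt => /orP[/eqP ->|jm].
    by have : 0 <= K' * peak_part p; [rewrite mulr_ge0 | lra].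
  by have := H2 (Ordinal jm) p => /=; have := normr_ge0 p`_m'; lra.
- move=> p; rewrite /step_norm coefB coefZ coefXn eqxx mulr1 subrr normr0 addr0.
  congr (_ + _); apply/eqP; rewrite eq_le; apply/andP; split.
    have := sP.1 (p - p`_m' *: 'X^m') (p`_m' *: 'X^m').
    by rewrite subrK sP.2 peak_part_high mulr0 addr0.
  have := seminormB sP p (p`_m' *: 'X^m').
  by rewrite sP.2 peak_part_high mulr0 addr0.
Qed.

Lemma coef_high_small p : (size p <= n)%N -> p`_m' = 0.
Proof. by move=> pn; rewrite nth_default// (leq_trans pn)// leq_pmull. Qed.

Lemma step_norm_small p : (size p <= n)%N -> step_norm p = N p.
Proof.
move=> pn; rewrite /step_norm /peak_part coef_high_small// normr0 addr0.
by rewrite block0_id// tail_blocks_small//; exact: (peak_norm0 M sN ht).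
Qed.

Variable d : R.
Hypotheses (d0 : 0 < d) (d1 : d <= 1) (ed : e <= d / 2) (cd : c <= d / 8).

Lemma step_spreads : (0 < M)%N ->
  expect w (fun t => h t ^+ 2) <= (d / 2) ^+ 2 * M%:R ->
  spreads d m N m' step_norm.
Proof.
move=> M0 hM x y xn yn.
(* The polynomial [y] moved into block [i + 1], that is, the vector [y h_i]. *)
pose z (i : 'I_M) := y * 'X^(i.+1 * n).
exists M, z; split=> //.
have zn (i : 'I_M) : (size (z i) <= m')%N.
  apply: leq_trans (size_polyMleq _ _) _; rewrite size_polyXn addnS/=.
  apply: (@leq_trans (n + i.+1 * n)%N); first by rewrite leq_add2r.
  by rewrite -mulSn leq_mul2r ltnS ltn_ord orbT.
have zm (i : 'I_M) : (z i)`_m' = 0 by rewrite nth_default.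
have z0 (i : 'I_M) : block n 0 (z i) = 0 by rewrite block_shift.
have zt (i : 'I_M) : tail_blocks (z i) = single_peak i y.
  by apply/funext => k; rewrite /tail_blocks block_shift// eqSS.
have Ny := seminorm_ge0 sN y; have Nx := seminorm_ge0 sN x.
have dy : 0 <= d * N y by rewrite mulr_ge0 ?(ltW d0).
have dx : 0 <= d * N x by rewrite mulr_ge0 ?(ltW d0).
have ey := ler_wpM2r Ny ed; have cx := ler_wpM2r Nx cd.
split.
- by move=> i; rewrite (leq_trans (zn i)).
- move=> i; rewrite /step_norm /peak_part zm normr0 addr0 z0 zt.
  apply: le_trans (peak_norm_le sN ht _ _ _) _.
  by rewrite total_norm_single// seminorm0//; lra.
- move=> i; rewrite /step_norm /peak_part coefD zm coef_high_small// addr0 normr0.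
  rewrite blockD z0 tail_blocksD zt block0_id// !addr0 tail_blocks_small//.
  rewrite (_ : (fun k => 0 + single_peak i y k) = single_peak i y); last first.
    by apply/funext => k; rewrite add0r.
  by apply: le_trans (peak_norm_single_ge sN ht ge0e x y i); lra.
- have zs : (\sum_i z i)`_m' = 0 by rewrite coef_sum big1// => i _; exact: zm.
  rewrite /step_norm coefB coefZ zs coef_high_small// mulr0 subr0 normr0 addr0 /peak_part.
  have bE k : block n k (\sum_i z i) =
      \sum_(i < M) if k == i.+1 then y else 0.
    rewrite /block drop_poly_sum take_poly_sum; apply: eq_bigr => i _.
    exact: block_shift.
  rewrite -scaleN1r blockD !blockZ bE big1 ?scaler0 ?add0r ?scaleN1r ?block0_id//.
  rewrite (_ : tail_blocks _ = fun=> M%:R^-1 *: y); last first.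
    apply/funext => k; rewrite /tail_blocks -scaleN1r blockD !blockZ bE blockS_small//.
    rewrite scaler0 addr0 (bigD1 k)//= eqxx big1 ?addr0// => i /negPf ik.
    by rewrite eqSS eq_sym -[_ == _]/(i == k) ik.
  have d20 : 0 <= d / 2 by rewrite divr_ge0// ltW.
  apply: le_trans (peak_norm_mean_le e sN ht y M0 d20 hM) _.
  by rewrite mulrDl; lra.
Qed.

(** The deviation constant [k] is at most [d / 8 * e], while [total_norm] is at most
    [peak_part / e]; hence the errors of [peak_proj] become small multiples of the norm, and
    [d <= 1] leaves room to divide by [1 - d / 4] or [1 - d / 8 * 3]. *)
Lemma step_projection (s : R) : 0 <= s -> c <= s ^+ 2 ->
  K * (K * s * n%:R) <= d / 8 * e ->
  exists Q, almost_projection d m N step_norm Q.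
Proof.
move=> s0 cs; set k := K * _ => ke.
have k0 : 0 <= k by rewrite !mulr_ge0.
have dd : d * d <= d by rewrite -[leRHS]mulr1 ler_pM2l.
have dp := d0; have dl := d1.
have d4 : 0 < 1 - d / 4 by lra.
have d83 : 0 < 1 - d / 8 * 3 by lra.
have dev v : expect (prod_weight w (M := M))
    (fun o => N (cut_sum N h v o - cut_mean N w h v)) <= k * total_norm N v.
  apply: (cut_dev sN ht (l := fun (j : 'I_n) p => p`_j)) => // j a u.
  by rewrite coef_sum; apply: eq_bigr => i _; rewrite coefZ.
have kt p : k * total_norm N (tail_blocks p) <= d / 8 * peak_part p.
  apply: le_trans (ler_wpM2l k0 (total_norm_tail p)) _.
  have pp : 0 <= peak_part p by exact: seminorm_ge0 peak_part_seminorm _.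
  by rewrite mulrCA mulrC ler_wpM2r// ler_pdivrMr.
pose Q p := peak_proj N w h (block n 0 p) (tail_blocks p).
have Q_le p : N (Q p) <= (1 + d) * peak_part p.
  have pp : 0 <= peak_part p by exact: seminorm_ge0 peak_part_seminorm _.
  have nn : 0 <= N (Q p) by exact: seminorm_ge0.
  have := peak_proj_le sN ht ge0e dev (block n 0 p) (tail_blocks p).
  rewrite -/(Q p) -/(peak_part p) => H.
  have := kt p => H2.
  have : (1 - d / 4) * N (Q p) <= (1 + d / 8) * peak_part p.
    by have := ler_wpM2r nn cd; lra.
  move=> H3; have : (1 - d / 4) * N (Q p) <= (1 - d / 4) * ((1 + d) * peak_part p).
    apply: le_trans H3 _; rewrite mulrA ler_wpM2r//; nra.
  by rewrite ler_pM2l.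
have pS p : peak_part p <= step_norm p by rewrite lerDl.
exists Q; split.
- move=> p; apply: leq_trans (size_polyD _ _) _; rewrite geq_max size_block/=.
  apply: leq_trans (size_sum _ _ _) _; apply/bigmax_leqP => i _.
  exact: leq_trans (size_scale_leq _ _) (size_block _ _ _).
- move=> p pn; rewrite /Q /peak_proj block0_id// tail_blocks_small// /cut_mean big1 ?addr0// => i _.
  by rewrite scaler0.
- by move=> p; apply: le_trans (Q_le p) _; rewrite ler_wpM2l// addr_ge0// ltW.
- move=> a p q; rewrite /Q blockD blockZ tail_blocksD tail_blocksZ; set D := (_ - _ - _).
  have := peak_proj_almost_linear sN ht k0 dev
    a (block n 0 p) (tail_blocks p) (block n 0 q) (tail_blocks q).
  rewrite -/D => H; have nD := seminorm_ge0 sN D.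
  have := kt q; have := ler_wpM2l (normr_ge0 a) (kt p).
  have := pS q; have := ler_wpM2l (normr_ge0 a) (pS p).
  have := ler_wpM2r nD cd; move: H.
  set x := `|a| * step_norm p; set y := step_norm q.
  have : 0 <= `|a| * peak_part p by rewrite mulr_ge0// (seminorm_ge0 peak_part_seminorm).
  have := seminorm_ge0 peak_part_seminorm q.
  move: (N D) nD => z nD; move: (peak_part p) (peak_part q) => u v v0 u0 H1 H2 H3 H4 H5 H6.
  have H7 : (1 - d / 8 * 3) * z <= 2 * (d / 8) * (x + y).
    have : d / 8 * (`|a| * u) <= d / 8 * x by rewrite ler_wpM2l// divr_ge0// ltW.
    have : d / 8 * v <= d / 8 * y by rewrite ler_wpM2l// divr_ge0// ltW.
    lra.
  have xy : 0 <= x + y by lra.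
  have : (1 - d / 8 * 3) * z <= (1 - d / 8 * 3) * (d * (x + y)).
    apply: le_trans H7 _; rewrite [leRHS]mulrA ler_wpM2r//; nra.
  by rewrite ler_pM2l.
- move=> p q qn; rewrite /step_norm coefD (coef_high_small qn) addr0.
  rewrite {1}/peak_part blockD tail_blocksD (tail_blocks_small qn) (block0_id qn).
  rewrite (_ : (fun i => tail_blocks p i + 0) = tail_blocks p); last first.
    by apply/funext => i; rewrite addr0.
  have := peak_norm_shift sN ht e dev (block n 0 p) q (tail_blocks p).
  rewrite -/(peak_part p) -/(Q p).
  have := kt p; have := Q_le p.
  have pp : 0 <= peak_part p by exact: seminorm_ge0 peak_part_seminorm _.
  have nn : 0 <= N (Q p) by exact: seminorm_ge0.
  have : 0 <= d * N q by rewrite mulr_ge0 ?seminorm_ge0// ltW.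
  have : 0 <= d * `|p`_m'| by rewrite mulr_ge0// ltW.
  have := ler_wpM2r nn cd => H1 H2 H3 H4 H5 H6.
  have : d / 8 * N (Q p) <= d / 8 * (2 * peak_part p).
    rewrite ler_wpM2l ?divr_ge0 ?(ltW d0)//; apply: le_trans H4 _.
    by rewrite ler_wpM2r//; lra.
  have := mulr_ge0 (ltW d0) pp; lra.
Qed.

End Step.

(** Order of the choices: [e] from [d]; then [s] from [e], the equivalence constant [K] and the
    dimension; then [h] with [c = s ^+ 2]; finally [M], large compared with the second moment of
    this [h]. *)
Lemma refine_exists m N (d : R) : stage m N -> 0 < d -> d <= 1 ->
  exists m' N', stage m' N' /\ refines d m N m' N'.
Proof.
move=> [sN [K K0 [NK KN]] _] d0 d1.
pose e := d / 2; have e0 : 0 < e by rewrite divr_gt0.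
have KK : 0 < 1 + K * K * m.+1%:R by rewrite ltr_pwDl// !mulr_ge0.
(* The denominator absorbs the factor [K * K * m.+1] of the deviation bound; the added 1 keeps it
   positive and gives [s <= d / 8 * e]. *)
pose s := d / 8 * e / (1 + K * K * m.+1%:R).
have s0 : 0 < s by rewrite divr_gt0// mulr_gt0// divr_gt0.
have sE : s * (1 + K * K * m.+1%:R) = d / 8 * e by rewrite divfK// gt_eqF.
have s1 : s <= d / 8 * e.
  by rewrite -sE ler_peMr ?(ltW s0)// lerDl !mulr_ge0.
have cd : s ^+ 2 <= d / 8.
  have : s <= d / 8 by apply: le_trans s1 _; rewrite /e; nra.
  by nra.
have [T [w [h ht]]] := heavy_tailed_exists (exprn_gt0 2 s0).
have [M M0 hM] : exists2 M, (0 < M)%N &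
    expect w (fun t => h t ^+ 2) <= (d / 2) ^+ 2 * M%:R.
  have Eh0 : 0 <= expect w (fun t => h t ^+ 2) / (d / 2) ^+ 2.
    rewrite divr_ge0 ?sqr_ge0//; apply: expect_ge0 (ht_prob ht) _ => t.
    exact: sqr_ge0.
  exists (Num.bound (expect w (fun t => h t ^+ 2) / (d / 2) ^+ 2)).+1 => //.
  rewrite mulrC -ler_pdivrMr ?exprn_gt0 ?divr_gt0//.
  by apply: le_trans (ltW (archi_boundP Eh0)) _; rewrite ler_nat.
exists (M.+1 * m.+1)%N, (step_norm m N w h e M); split.
  exact: (step_stage sN K0 NK KN M ht e0).
split.
- by rewrite mulSn addSn ltnS leq_addr.
- exact: (step_norm_small sN e M ht).
- exact: (step_spreads sN ht e0 d0 _ cd M0 hM).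
- apply: (step_projection sN K0 NK KN M ht e0 d0 d1 cd (ltW s0)) => //.
  by apply: le_trans (_ : _ <= s * (1 + K * K * m.+1%:R)) _; [nra|rewrite sE].
Qed.

End Stage.

(** * The limit space *)

Section Tower.
Variable R : realType.
Implicit Types (k j : nat) (p q x y : {poly R}).

(** The errors are halved so that those of all later projections add up to a multiple of the first;
    starting at [8^-1] keeps [8 * stage_error k] at most 1. *)
Definition stage_error k : R := 8^-1 * 2 ^- k.

Lemma stage_error_gt0 k : 0 < stage_error k.
Proof. by rewrite mulr_gt0 ?invr_gt0 ?exprn_gt0. Qed.

Lemma stage_error_le k : stage_error k <= 8^-1.
Proof.
by rewrite ger_pMr ?invr_gt0// invf_le1 ?exprn_gt0// exprn_ege1// ler1n.
Qed.

Lemma stage_error_le1 k : stage_error k <= 1.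
Proof. by apply: le_trans (stage_error_le k) _; rewrite invf_le1 ?ler1n. Qed.

Lemma stage_errorS k : stage_error k = 2 * stage_error k.+1.
Proof. by rewrite /stage_error exprS invfM; move: (2 ^- k) => t; field. Qed.

Lemma stage_error_small (d : R) : 0 < d ->
  exists k0, forall k, (k0 <= k)%N -> 8 * stage_error k <= d.
Proof.
move=> d0; have di : 0 <= d^-1 by rewrite invr_ge0 ltW.
exists (Num.bound d^-1) => k kk.
rewrite /stage_error mulrA divff ?pnatr_eq0// mul1r invf_ple ?posrE ?exprn_gt0//.
apply: le_trans (ltW (archi_boundP di)) _.
rewrite -natrX ler_nat; exact: leq_trans kk (ltnW (ltn_expl _ _)).
Qed.

(** The tower starts from the real line, realised as constants; the complement of the summand
    spanned by ['X^0] is null. *)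
Lemma stage0 : stage 0 (fun p => `|p`_0|).
Proof.
split.
- by split=> [p q|a p]; rewrite ?coefD ?coefZ ?normrM ?ler_normD.
- exists 1 => //; split=> [p|j p]; rewrite mul1r ?big_ord1//.
  by rewrite ord1.
- by move=> p; rewrite coefB coefZ coefXn eqxx mulr1 subrr normr0 add0r.
Qed.

Lemma tower_exists : exists (mm : nat -> nat) (NN : nat -> {poly R} -> R),
  forall k, stage (mm k) (NN k) /\ refines (stage_error k) (mm k) (NN k) (mm k.+1) (NN k.+1).
Proof.
(* Each stage travels with its proof, since the choice of the next one depends on it. *)
pose S := {s : nat * ({poly R} -> R) | stage s.1 s.2}.
have nxt k (s : S) : {s' : S |
    refines (stage_error k) (sval s).1 (sval s).2 (sval s').1 (sval s').2}.
  apply: cid; have [m' [N' [sN' rN']]] :=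
    refine_exists (svalP s) (stage_error_gt0 k) (stage_error_le1 k).
  by exists (exist _ (m', N') sN').
pose st := fix st k : S :=
  if k is k'.+1 then sval (nxt k' (st k')) else exist _ (0%N, _) stage0.
exists (fun k => (sval (st k)).1), (fun k => (sval (st k)).2) => k.
by split; [exact: svalP (st k)|exact: svalP (nxt k (st k))].
Qed.

(** * The limit norm and the composed projections *)

Section Limit.
Variables (mm : nat -> nat) (NN : nat -> {poly R} -> R) (QQ : nat -> {poly R} -> {poly R}).
Hypothesis stg : forall k, stage (mm k) (NN k).
Hypothesis ref : forall k, refines (stage_error k) (mm k) (NN k) (mm k.+1) (NN k.+1).
Hypothesis prj : forall k, almost_projection (stage_error k) (mm k) (NN k) (NN k.+1) (QQ k).

Definition level k p : Prop := (size p <= (mm k).+1)%N.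

(** All stages containing [p] give the same value, and stage [size p] contains [p] because [mm] is
    strictly increasing. *)
Definition lim_norm p : R := NN (size p) p.

Lemma mm_leq k j : (k <= j)%N -> (mm k <= mm j)%N.
Proof.
elim: j => [|j IH]; first by rewrite leqn0 => /eqP ->.
rewrite leq_eqVlt => /orP[/eqP -> //|/IH H].
exact: leq_trans H (ltnW (rf_lt (ref j))).
Qed.

Lemma level_leq k j p : (k <= j)%N -> level k p -> level j p.
Proof. by move=> /mm_leq kj H; rewrite /level (leq_trans H). Qed.

Lemma level_size p : level (size p) p.
Proof.
have mk k : (k <= mm k)%N by elim: k => // k IH; exact: leq_ltn_trans IH (rf_lt (ref k)).
exact: leq_trans (mk _) (leqnSn _).
Qed.

Lemma levelD k p q : level k p -> level k q -> level k (p + q).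
Proof. by move=> hp hq; rewrite /level (leq_trans (size_polyD _ _))// geq_max hp. Qed.

Lemma levelZ k a p : level k p -> level k (a *: p).
Proof. exact: leq_trans (size_scale_leq _ _). Qed.

Lemma levelN k p : level k p -> level k (- p).
Proof. by rewrite /level size_polyN. Qed.

Lemma levelB k p q : level k p -> level k q -> level k (p - q).
Proof. by move=> hp hq; apply: levelD => //; exact: levelN. Qed.

Lemma NN_stable k j p : (k <= j)%N -> level k p -> NN j p = NN k p.
Proof.
elim: j => [|j IH]; first by rewrite leqn0 => /eqP ->.
rewrite leq_eqVlt => /orP[/eqP -> //|kj] hp.
have hj : level j p by exact: level_leq hp.
by rewrite (rf_eq (ref j)) ?IH.
Qed.

Lemma lim_normE k p : level k p -> lim_norm p = NN k p.
Proof.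
move=> hp; rewrite /lim_norm -(NN_stable (leq_maxl k (size p)) hp).
by rewrite (NN_stable (leq_maxr k (size p)) (level_size p)).
Qed.

Lemma lim_norm_seminorm : seminorm lim_norm.
Proof.
split=> [p q|a p].
  have hp := level_leq (leq_maxl (size p) (size q)) (level_size p).
  have hq := level_leq (leq_maxr (size p) (size q)) (level_size q).
  by rewrite (lim_normE hp) (lim_normE hq) (lim_normE (levelD hp hq)) (st_seminorm (stg _)).1.
have hp := level_size p.
by rewrite (lim_normE hp) (lim_normE (levelZ a hp)) (st_seminorm (stg _)).2.
Qed.

Lemma lim_norm_eq0 p : lim_norm p = 0 -> p = 0.
Proof.
move=> p0; have [K _ [_ KN]] := st_equiv (stg (size p)); apply/polyP => j.
rewrite coef0; have [jp|jp] := ltnP j (mm (size p)).+1.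
  have := KN (Ordinal jp) p; rewrite /= -/(lim_norm p) p0 mulr0 normr_le0.
  by move=> /eqP.
by rewrite nth_default// (leq_trans (level_size p)).
Qed.

Lemma lim_norm_spread (d : R) x y : 0 < d ->
  exists M (z : 'I_M -> {poly R}), (0 < M)%N /\
   [/\ forall i, lim_norm (z i) <= (1 + d) * lim_norm y,
       forall i, (1 - d) * (lim_norm x + lim_norm y) <= lim_norm (x + z i)
     & lim_norm (M%:R^-1 *: (\sum_i z i) - y) <= d * lim_norm y].
Proof.
move=> d0; have [k0 Hk] := stage_error_small d0.
pose k := maxn k0 (maxn (size x) (size y)).
have hx : level k x.
  by apply: level_leq (level_size x); rewrite !leq_max leqnn orbT.
have hy : level k y.
  by apply: level_leq (level_size y); rewrite !leq_max leqnn !orbT.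
have dk := Hk k (leq_maxl _ _); have dk0 := stage_error_gt0 k.
have [M [z [M0 [zs z1 z2 z3]]]] := rf_spreads (ref k) hx hy.
have hs : level k.+1 (\sum_i z i).
  by apply: (big_ind (level k.+1)) => //;
    [rewrite /level size_poly0|exact: levelD|move=> i _; exact: zs].
have hx' := level_leq (leqnSn k) hx; have hy' := level_leq (leqnSn k) hy.
have Nx := seminorm_ge0 lim_norm_seminorm x; have Ny := seminorm_ge0 lim_norm_seminorm y.
have dy : stage_error k * lim_norm y <= d * lim_norm y by rewrite ler_wpM2r//; lra.
have dx : stage_error k * lim_norm x <= d * lim_norm x by rewrite ler_wpM2r//; lra.
exists M, z; split=> //; split=> [i|i|].
- by have := z1 i; rewrite -(lim_normE (zs i)) -(lim_normE hy); lra.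
- have := z2 i; rewrite -(lim_normE hx) -(lim_normE hy).
  by rewrite -(lim_normE (levelD hx' (zs i))); lra.
- move: z3; rewrite -(lim_normE hy) -(lim_normE (levelB (levelZ _ hs) hy')); lra.
Qed.

(** The composite of [QQ k], ..., [QQ (k + j - 1)], the last one applied first, from level [k + j]
    down to level [k]. *)
Fixpoint descend k j p : {poly R} :=
  if j is j'.+1 then QQ k (descend k.+1 j' p) else p.

Lemma descend_stable k j p : level (k + j) p -> descend k j.+1 p = descend k j p.
Proof.
elim: j k => [|j IH] k hp /=; first by rewrite (ap_id (prj k))//; move: hp; rewrite addn0.
by congr (QQ k _); apply: IH; rewrite addSnnS.
Qed.

Lemma descend_stable_leq k j j' p : (j <= j')%N -> level (k + j) p ->
  descend k j' p = descend k j p.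
Proof.
elim: j' => [|j' IH]; first by rewrite leqn0 => /eqP ->.
rewrite leq_eqVlt => /orP[/eqP -> //|jj] hp.
by rewrite descend_stable ?IH//; apply: level_leq hp; rewrite leq_add2l.
Qed.

(** None of the bounds depends on [j], so they persist when all later projections are composed. *)
Record descend_spec k j : Prop := {
  ds_level : forall p, level (k + j) p -> level k (descend k j p);
  ds_id : forall p, level k p -> descend k j p = p;
  ds_le : forall p, level (k + j) p ->
    lim_norm (descend k j p) <= (1 + 8 * stage_error k) * lim_norm p;
  ds_linear : forall a p q, level (k + j) p -> level (k + j) q ->
    lim_norm (descend k j (a *: p + q) - a *: descend k j p - descend k j q)
    <= 8 * stage_error k * (`|a| * lim_norm p + lim_norm q);
  ds_shift : forall p q, level (k + j) p -> level k q ->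
    lim_norm (p + q) <= lim_norm p + lim_norm (descend k j p + q)
      - lim_norm (descend k j p) + 8 * stage_error k * (lim_norm p + lim_norm q)
}.

(* The first projection is composed with all later ones together: the defect
   [d'] of the latter enters the composite as [(1 + 4 d) d' + 2 d], so that the
   bound [8 stage_error] reproduces itself. *)
Lemma descendP k j : descend_spec k j.
Proof.
have sN := lim_norm_seminorm.
elim: j k => [|j IH] k.
  have d0 := stage_error_gt0 k; split=> //=.
  - by move=> p; rewrite addn0.
  - by move=> p _; have := mulr_ge0 (ltW d0) (seminorm_ge0 sN p); lra.
  - move=> a p q _ _.
    rewrite addrAC addrK subrr seminorm0//; apply: mulr_ge0.
      by rewrite mulr_ge0// ltW.
    exact: addr_ge0 (mulr_ge0 (normr_ge0 a) (seminorm_ge0 sN p)) (seminorm_ge0 sN q).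
  - move=> p q _ _; have Np := mulr_ge0 (ltW d0) (seminorm_ge0 sN p).
    by have Nq := mulr_ge0 (ltW d0) (seminorm_ge0 sN q); lra.
have [I1 I2 I3 I4 I5] := IH k.+1.
have d0 := stage_error_gt0 k; have d8 := stage_error_le k; have dS := stage_errorS k.
set d := stage_error k in d0 d8 dS *.
set d' := 8 * stage_error k.+1 in I3 I4 I5.
have d'E : d' = 4 * d by rewrite /d' dS; ring.
have dd : d * d <= 8^-1 * d by rewrite ler_pM2r.
(* All three follow from [d' = 4 * d] and [d <= 8^-1]; [f2] becomes an equality at [d = 8^-1]. *)
have f1 : (1 + d) * (1 + d') <= 1 + 8 * d by rewrite d'E; lra.
have f2 : 2 * d + d' + 4 * d * d' <= 8 * d by rewrite d'E; lra.
have f3 : d * (1 + d') <= 2 * d by rewrite d'E; lra.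
have P := prj k; set Q := QQ k in P.
have lev p : level (k + j.+1) p -> level (k.+1 + j) p by rewrite addSnnS.
have Q_level p : level k (Q p) by exact: ap_size P p.
have QleN p : level k.+1 p -> lim_norm (Q p) <= (1 + d) * lim_norm p.
  by move=> hp; have := ap_le P p; rewrite (lim_normE hp) (lim_normE (Q_level p)).
have Qlin a p q : level k.+1 p -> level k.+1 q ->
   lim_norm (Q (a *: p + q) - a *: Q p - Q q) <= d * (`|a| * lim_norm p + lim_norm q).
  move=> hp hq; have := ap_linear P a p q; rewrite (lim_normE hp) (lim_normE hq).
  rewrite -(@lim_normE k)//.
  by apply: levelB (Q_level _); apply: levelB (Q_level _) (levelZ _ (Q_level _)).
split=> /=; rewrite -/Q -/d.
- by move=> p _; exact: Q_level.
- by move=> p hp; rewrite I2 ?(ap_id P)//; exact: level_leq (leqnSn k) hp.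
- move=> p /lev hp; have := I3 p hp; have := QleN _ (I1 p hp).
  have Np := seminorm_ge0 sN p.
  move=> H1 /(ler_wpM2l (_ : 0 <= 1 + d)) H2; have {}H2 := H2 (addr_ge0 ler01 (ltW d0)).
  apply: le_trans H1 (le_trans H2 _); by rewrite mulrA ler_wpM2r.
- move=> a p q /lev hp /lev hq.
  set p' := descend k.+1 j p; set q' := descend k.+1 j q.
  set r := descend k.+1 j (a *: p + q).
  have hp' : level k.+1 p' by exact: I1.
  have hq' : level k.+1 q' by exact: I1.
  have hr : level k.+1 r by apply: I1; exact: levelD (levelZ _ hp) hq.
  pose t := r - a *: p' - q'.
  have ht : level k.+1 t by apply: levelB hq'; exact: levelB hr (levelZ _ hp').
  have hB : level k.+1 (a *: p' + q') by exact: levelD (levelZ _ hp') hq'.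
  (* Almost linearity of [Q] is used twice, on [1 *: t + (a *: p' + q')] and on [a *: p' + q']. The
     vector [Q t] is small because [t] is the linearity defect of the later composite. *)
  have rE : r = 1 *: t + (a *: p' + q').
    by rewrite scale1r /t -[r - _ - _]addrA -opprD subrK.
  set s := `|a| * lim_norm p + lim_norm q.
  have s0 : 0 <= s.
    exact: addr_ge0 (mulr_ge0 (normr_ge0 a) (seminorm_ge0 sN p)) (seminorm_ge0 sN q).
  have Nt : lim_norm t <= d' * s by exact: I4.
  have s' : `|a| * lim_norm p' + lim_norm q' <= (1 + d') * s.
    have := I3 q hq; have := ler_wpM2l (normr_ge0 a) (I3 p hp).
    by rewrite -/p' -/q' /s; lra.
  have NB : lim_norm (a *: p' + q') <= (1 + d') * s.
    by apply: le_trans s'; apply: le_trans (sN.1 _ _) _; rewrite sN.2.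
  have E1 := Qlin 1 t _ ht hB; rewrite -rE normr1 mul1r scale1r in E1.
  have E2 := Qlin a p' q' hp' hq'.
  have E3 := QleN t ht.
  have -> : Q r - a *: Q p' - Q q' = (Q r - Q t - Q (a *: p' + q'))
     + (Q (a *: p' + q') - a *: Q p' - Q q') + Q t.
    move: (Q r) (a *: Q p') (Q q') (Q t) (Q _) => x1 x2 x3 x4 x5; ring.
  have := sN.1 ((Q r - Q t - Q (a *: p' + q'))
     + (Q (a *: p' + q') - a *: Q p' - Q q')) (Q t).
  have := sN.1 (Q r - Q t - Q (a *: p' + q')) (Q (a *: p' + q') - a *: Q p' - Q q').
  have F1 : d * (lim_norm t + lim_norm (a *: p' + q')) <= d * (d' * s + (1 + d') * s).
    by rewrite ler_pM2l// lerD.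
  have F2 : d * (`|a| * lim_norm p' + lim_norm q') <= d * ((1 + d') * s).
    by rewrite ler_pM2l.
  have F3 : (1 + d) * lim_norm t <= (1 + d) * (d' * s).
    by rewrite ler_wpM2l// addr_ge0// ltW.
  have : d * (d' * s + (1 + d') * s) + d * ((1 + d') * s) + (1 + d) * (d' * s)
     <= 8 * d * s.
    have -> : d * (d' * s + (1 + d') * s) + d * ((1 + d') * s) + (1 + d) * (d' * s)
       = (2 * d + d' + 4 * d * d') * s by ring.
    by rewrite ler_wpM2r.
  lra.
- move=> p q /lev hp hq; have hq' := level_leq (leqnSn k) hq.
  have := I5 p q hp hq'; set p' := descend k.+1 j p.
  have hp' : level k.+1 p' by exact: I1.
  have := ap_shift P p' hq; rewrite -(lim_normE hp') -(lim_normE hq).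
  rewrite -(lim_normE (levelD hp' hq')) -(lim_normE (levelD (Q_level p') hq)).
  rewrite -(lim_normE (Q_level p')).
  have N0 := seminorm_ge0 sN p; have N1 := seminorm_ge0 sN q.
  have := I3 p hp; rewrite -/p' => /(ler_wpM2l (ltW d0)) H1 H2 H3.
  have : d * ((1 + d') * lim_norm p) <= 2 * d * lim_norm p.
    by rewrite mulrA ler_wpM2r.
  have := mulr_ge0 (ltW d0) N0; have := mulr_ge0 (ltW d0) N1.
  rewrite -/d in H2; rewrite d'E in H1 H3 *; lra.
Qed.

(** [descend k j p] no longer depends on [j] once level [k + j] contains [p], and [j = size p] is
    large enough. *)
Definition limit_proj k p : {poly R} := descend k (size p) p.

Lemma limit_projE k j p : level (k + j) p -> limit_proj k p = descend k j p.
Proof.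
have hp : level (k + size p) p by apply: level_leq (level_size p); exact: leq_addl.
move=> hj; rewrite /limit_proj -(descend_stable_leq (leq_maxl (size p) j) hp).
by rewrite (descend_stable_leq (leq_maxr (size p) j) hj).
Qed.

Lemma lim_norm_summand k p : level k p ->
  lim_norm p = lim_norm (p - p`_(mm k) *: 'X^(mm k)) + `|p`_(mm k)|.
Proof.
move=> hp; have hX : level k 'X^(mm k) by rewrite /level size_polyXn.
rewrite (lim_normE hp) (lim_normE (levelB hp (levelZ _ hX))).
exact: st_summand (stg k) p.
Qed.

(** [u] spans the l1-summand of a late stage [k], and [c p] is the coordinate of the limit
    projection of [p] along it. For the last bound, shifting by [- c p *: u] lowers the norm of the
    projection by exactly [|c p|]; since [8 * t <= 1], this gain absorbs the error [8 * t * |c p|]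
    of the shift estimate. *)
Lemma lim_norm_functional (d : R) : 0 < d -> exists (u : {poly R}) (c : {poly R} -> R),
  [/\ lim_norm u = 1, c u = 1, forall p, `|c p| <= (1 + d) * lim_norm p,
      forall a p q, `|c (a *: p + q) - a * c p - c q| <= d * (`|a| * lim_norm p + lim_norm q)
    & forall p, lim_norm (p - c p *: u) <= (1 + d) * lim_norm p].
Proof.
move=> d0; have sN := lim_norm_seminorm.
have [k Hk] := stage_error_small d0; have dk := Hk k (leqnn k); have dk0 := stage_error_gt0 k.
have dk8 := stage_error_le k; set t := stage_error k in dk dk0 dk8.
have hX : level k 'X^(mm k) by rewrite /level size_polyXn.
have NX : lim_norm 'X^(mm k) = 1.
  rewrite (lim_norm_summand hX) coefXn eqxx scale1r subrr seminorm0//.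
  by rewrite add0r normr1.
have cN p : level k p -> `|p`_(mm k)| <= lim_norm p.
  by move=> hp; rewrite [leRHS](lim_norm_summand hp) lerDr seminorm_ge0.
pose P := limit_proj k.
have lev p : level (k + size p) p by apply: level_leq (level_size p); exact: leq_addl.
have Plev p : level k (P p) by apply: (ds_level (descendP k (size p))); exact: lev.
have Ple p : lim_norm (P p) <= (1 + 8 * t) * lim_norm p.
  by apply: (ds_le (descendP k (size p))); exact: lev.
have cle p : `|(P p)`_(mm k)| <= (1 + 8 * t) * lim_norm p.
  by exact: le_trans (cN _ (Plev p)) (Ple p).
have tN p : 8 * t * lim_norm p <= d * lim_norm p by rewrite ler_wpM2r ?seminorm_ge0.
exists 'X^(mm k), (fun p => (P p)`_(mm k)); split=> //.
- by rewrite /P /limit_proj (ds_id (descendP k _))// coefXn eqxx.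
- by move=> p; have := cle p; have := tN p; lra.
- move=> a p q; set j := maxn (size p) (size q).
  have hp : level (k + j) p.
    by apply: level_leq (level_size p); rewrite (leq_trans (leq_maxl _ _) (leq_addl _ _)).
  have hq : level (k + j) q.
    by apply: level_leq (level_size q); rewrite (leq_trans (leq_maxr _ _) (leq_addl _ _)).
  have hpq : level (k + j) (a *: p + q) by exact: levelD (levelZ _ hp) hq.
  have := ds_linear (descendP k j) a hp hq.
  rewrite -(limit_projE hp) -(limit_projE hq) -(limit_projE hpq) -/P.
  have hl : level k (P (a *: p + q) - a *: P p - P q).
    by apply: levelB (Plev _); apply: levelB (Plev _) (levelZ _ (Plev _)).
  move=> H; have := cN _ hl; rewrite !coefB coefZ.
  have := ler_wpM2l (normr_ge0 a) (tN p); have := tN q; rewrite -/t in H; lra.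
- move=> p; have hc := levelN (levelZ (P p)`_(mm k) hX).
  have := ds_shift (descendP k (size p)) (lev p) hc; rewrite -/(limit_proj k p) -/P -/t.
  have -> : lim_norm (- ((P p)`_(mm k) *: 'X^(mm k))) = `|(P p)`_(mm k)|.
    by rewrite (seminormN sN) sN.2 NX mulr1.
  rewrite (lim_norm_summand (Plev p)).
  set c := `|_|; have := cle p; have := tN p; rewrite -/c.
  have t81 : 8 * t <= 1 by lra.
  have : 8 * t * c <= 1 * c by rewrite ler_wpM2r// normr_ge0.
  lra.
Qed.

End Limit.

Lemma norm_exists : exists N : {poly R} -> R,
  [/\ seminorm N, forall p, N p = 0 -> p = 0,
      forall (d : R) x y, 0 < d -> exists M (z : 'I_M -> {poly R}), (0 < M)%N /\
       [/\ forall i, N (z i) <= (1 + d) * N y,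
           forall i, (1 - d) * (N x + N y) <= N (x + z i)
         & N (M%:R^-1 *: (\sum_i z i) - y) <= d * N y]
    & forall d : R, 0 < d -> exists (u : {poly R}) (c : {poly R} -> R),
       [/\ N u = 1, c u = 1, forall p, `|c p| <= (1 + d) * N p,
          forall a p q, `|c (a *: p + q) - a * c p - c q| <= d * (`|a| * N p + N q)
        & forall p, N (p - c p *: u) <= (1 + d) * N p]].
Proof.
have [mm [NN H]] := tower_exists.
have stg k := (H k).1; have ref k := (H k).2.
have /choice[QQ prj] k := rf_proj (ref k).
exists (lim_norm NN); split.
- exact: lim_norm_seminorm stg ref.
- exact: lim_norm_eq0 stg ref.
- by move=> d x y; exact: (lim_norm_spread stg ref).
- by move=> d; exact: (lim_norm_functional stg ref prj).
Qed.

End Tower.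

(** * Completion *)

(** A copy of [V] indexed by the proofs [sN] and [N0], so that [N] can be attached to it as its
    norm. *)
Definition renormed (R : realType) (V : lmodType R) (N : V -> R)
  (sN : seminorm N) (N0 : forall x, N x = 0 -> x = 0) : Type := V.

Section Renormed.
Variables (R : realType) (V : lmodType R) (N : V -> R).
Variables (sN : seminorm N) (N0 : forall x, N x = 0 -> x = 0).
HB.instance Definition _ := GRing.Lmodule.copy (renormed sN N0) V.
HB.instance Definition _ :=
  Lmodule_isNormed.Build R (renormed sN N0) sN.1 sN.2 N0.
End Renormed.

Lemma free_ultrafilter_exists : inhabited freeUltrafilter.
Proof.
have [G [GU sFG]] := ultraFilterLemma (F := \oo) _.
constructor; apply: (FreeUltrafilter (fu_sets := G)) => //.
apply/seteqP; split=> // k Gk.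
have Gk' : G [set i | (k < i)%N] by apply: sFG; exact: nbhs_infty_gt.
by have := Gk _ Gk'; rewrite /= ltnn.
Qed.

Section Completion.
Variables (R : realType) (E : normedModType R) (U : freeUltrafilter).

Lemma bounded_cst (x : E) : (fun _ : nat => x) \in @bounded_seq R E.
Proof. by apply/asboolP; exists `|x|. Qed.

(** Constant sequences embed [E] isometrically into its ultrapower, which is complete; the closure
    of the image therefore serves as the completion of [E]. *)
Definition up_embed (x : E) : ultrapower E U := up_class U (Linfty (bounded_cst x)).

Lemma up_embed_norm x : `|up_embed x| = `|x|.
Proof. by rewrite up_normE; apply: ulim_norm_eq; exact: cvg_cst. Qed.

Lemma up_embed_linear a x y : up_embed (a *: x + y) = a *: up_embed x + up_embed y.
Proof.
rewrite /up_embed -[a *: up_class _ _]/(up_scale a _) -up_classZ -up_classD.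
by congr (up_class U _); exact: val_inj.
Qed.

Lemma up_embed0 : up_embed 0 = 0.
Proof. by apply/eqP; rewrite -normr_eq0 up_embed_norm normr0. Qed.

Definition in_closure : {pred (ultrapower E U)} :=
  [pred q | `[< forall e : R, 0 < e -> exists x, `|q - up_embed x| <= e >]].

Lemma in_closure_submod_closed : submod_closed in_closure.
Proof.
split=> [|a p q /asboolP pE /asboolP qE]; apply/asboolP.
  by move=> e e0; exists 0; rewrite up_embed0 subr0 normr0 ltW.
move=> e e0; have a0 : 0 < `|a| + 1 by rewrite ltr_wpDl.
have [x px] := pE _ (divr_gt0 (divr_gt0 e0 (ltr0n R 2)) a0).
have [y qy] := qE _ (divr_gt0 e0 (ltr0n R 2)).
exists (a *: x + y); rewrite up_embed_linear opprD addrACA -scalerBr.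
apply: le_trans (ler_normD _ _) _; rewrite normrZ [leRHS](splitr e) lerD//.
apply: (@le_trans _ _ ((`|a| + 1) * `|p - up_embed x|)).
  by rewrite ler_wpM2r// lerDl.
by rewrite mulrC -ler_pdivlMr.
Qed.
HB.instance Definition _ :=
  GRing.isSubmodClosed.Build R (ultrapower E U) in_closure in_closure_submod_closed.

Record completion := Completion {
  completion_val : ultrapower E U;
  completion_valP : completion_val \in in_closure
}.
HB.instance Definition _ := [isSub for completion_val].
HB.instance Definition _ := [Choice of completion by <:].
HB.instance Definition _ := [SubChoice_isSubLmodule of completion by <:].

Definition completion_norm (q : completion) : R := `|completion_val q|.

Lemma completion_normD p q :
  completion_norm (p + q) <= completion_norm p + completion_norm q.
Proof. exact: ler_normD. Qed.

Lemma completion_normZ a q : completion_norm (a *: q) = `|a| * completion_norm q.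
Proof. exact: normrZ. Qed.

Lemma completion_norm0_eq0 q : completion_norm q = 0 -> q = 0.
Proof. by move=> /normr0_eq0 q0; exact: val_inj. Qed.

HB.instance Definition _ := Lmodule_isNormed.Build R completion
  completion_normD completion_normZ completion_norm0_eq0.

Lemma completion_complete (F : set_system completion) :
  ProperFilter F -> cauchy F -> cvg F.
Proof.
move=> PF /cauchyP Fc.
have cG : cauchy (completion_val @ F).
  apply/cauchyP => e e0; have [q Fq] := Fc e e0; exists (completion_val q).
  suff : F [set z | ball (completion_val q) e (completion_val z)] by [].
  by apply: filterS Fq => z; rewrite -ball_normE => qz; rewrite /= -ball_normE.
have /cvg_ex[l /fcvg_ballP Gl] : cvg (completion_val @ F).
  exact: cauchy_cvg cG.
have {}Gl e : 0 < e -> F [set z | ball l e (completion_val z)] by exact: Gl.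
have lE : l \in in_closure.
  apply/asboolP => e e0; have e2 : 0 < e / 2 by rewrite divr_gt0.
  have [q] := filter_ex (Gl _ e2); rewrite -ball_normE/= => lq.
  have /asboolP/(_ _ e2)[x qx] := completion_valP q; exists x.
  rewrite -(subrKA (completion_val q)) (le_trans (ler_normD _ _))//.
  by rewrite [leRHS](splitr e) lerD// ltW.
apply/cvg_ex; exists (Completion lE); apply/fcvg_ballP => e e0.
by apply: filterS (Gl e e0) => q /=; rewrite -ball_normE => lq; rewrite -ball_normE.
Qed.

HB.instance Definition _ := Uniform_isComplete.Build completion completion_complete.

Lemma embed_in_closure x : up_embed x \in in_closure.
Proof. by apply/asboolP => e e0; exists x; rewrite subrr normr0 ltW. Qed.

Definition to_completion (x : E) : completion := Completion (embed_in_closure x).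

End Completion.

Lemma completion_exists (R : realType) (E : normedModType R) :
  exists (X : completeNormedModType R) (f : E -> X),
  [/\ forall a x y, f (a *: x + y) = a *: f x + f y, forall x, `|f x| = `|x|
    & forall q (e : R), 0 < e -> exists x, `|q - f x| <= e].
Proof.
have [U] := free_ultrafilter_exists.
exists (completion E U : completeNormedModType R), (@to_completion R E U); split.
- by move=> a x y; apply: val_inj; exact: up_embed_linear.
- exact: up_embed_norm.
- by move=> q e e0; have /asboolP/(_ _ e0) := completion_valP q.
Qed.

(** * The Daugavet property *)

Section OperatorNorm.
Variables (R : realType) (X : normedModType R).
Implicit Types T : {linear X -> X}.

Lemma opnorm_le T (B : R) : (forall x, `|T x| <= B * `|x|) -> 0 <= B -> opnorm T <= B.
Proof.
move=> TB B0; apply: ge_sup.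
  by exists `|T 0|, 0 => //=; rewrite normr0.
move=> _ [x /= x1 <-]; apply: le_trans (TB x) _.
by rewrite -[leRHS]mulr1 ler_wpM2l.
Qed.

Lemma opnorm_has_sup T : bounded_operator T ->
  has_sup [set `|T x| | x in [set x : X | `|x| <= 1]].
Proof.
move=> [B TB]; split; first by exists `|T 0|, 0 => //=; rewrite normr0.
exists `|B| => _ [y /= y1 <-]; apply: le_trans (TB y) _.
apply: le_trans (ler_wpM2r (normr_ge0 y) (ler_norm B)) _.
by rewrite -[leRHS]mulr1 ler_wpM2l.
Qed.

Lemma opnorm_ge0 T : bounded_operator T -> 0 <= opnorm T.
Proof.
move=> bT; apply: (sup_upper_bound (opnorm_has_sup bT)).
by exists 0; rewrite /= ?linear0 ?normr0.
Qed.

Lemma le_opnorm T x : bounded_operator T -> `|T x| <= opnorm T * `|x|.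
Proof.
move=> bT; have [->|x0] := eqVneq x 0; first by rewrite linear0 !normr0 mulr0.
have nx : 0 < `|x| by rewrite normr_gt0.
rewrite -ler_pdivrMr//; apply: (sup_upper_bound (opnorm_has_sup bT)).
exists (`|x|^-1 *: x) => /=; last first.
  by rewrite linearZ normrZ ger0_norm ?invr_ge0// mulrC.
by rewrite normrZ ger0_norm ?invr_ge0// mulVf// gt_eqF.
Qed.

End OperatorNorm.

Lemma exists_ge_mean (R : realType) (M : nat) (s : 'I_M -> R) : (0 < M)%N ->
  exists i, M%:R^-1 * (\sum_i s i) <= s i.
Proof.
move=> M0; pose i0 := Ordinal M0.
case: (@Order.TotalTheory.arg_maxP _ _ _ i0 xpredT s isT) => i _ si; exists i.
rewrite ler_pdivrMl ?ltr0n// mulr_natl -[M in leRHS]card_ord -sumr_const.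
by apply: ler_sum => k _; exact: si.
Qed.

(** The value at [u] is only required to be within [d] of 1, because on the completion the
    functional is evaluated at an approximant of [u]. *)
Definition almost_functional (R : realType) (X : normedModType R) (d : R)
    (u : X) (c : X -> R) : Prop :=
  [/\ `|u| = 1, `|c u - 1| <= d, forall p, `|c p| <= (1 + d) * `|p|,
      forall a p q, `|c (a *: p + q) - a * c p - c q| <= d * (`|a| * `|p| + `|q|)
    & forall p, `|p - c p *: u| <= (1 + d) * `|p|].

(** * Lower bound for [Daug] *)

Section NotUniform.
Variables (R : realType) (X : normedModType R).

(** Splitting off one term costs at most [2 * d], since its weight and the norm of the remaining sum
    are at most 1. *)
Lemma almost_functional_sum (d : R) (u : X) c n (a : 'I_n -> X) (l : 'I_n -> R) :
  almost_functional d u c -> 0 <= d -> (forall k, `|a k| = 1) -> (forall k, 0 <= l k) ->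
  \sum_k l k <= 1 ->
  `|c (\sum_k l k *: a k) - \sum_k l k * c (a k)| <= 2 * d * n%:R.
Proof.
move=> [_ _ c1 c2 _] d0; elim: n a l => [|n IH] a l a1 l0 l1.
  rewrite !big_ord0 mulr0 subr0; have := c1 0.
  by rewrite normr0 mulr0.
rewrite !big_ord_recl; set s := \sum_(i < n) _ *: _; set t := \sum_(i < n) _ * _.
have l0' k : 0 <= l (lift ord0 k) by exact: l0.
move: l1; rewrite big_ord_recl => l1.
have sl : 0 <= \sum_(i < n) l (lift ord0 i) by exact: sumr_ge0.
have H := IH (fun k => a (lift ord0 k)) (fun k => l (lift ord0 k)) (fun k => a1 _) l0' _.
have {}H : `|c s - t| <= 2 * d * n%:R by apply: H; have := l0 ord0; lra.
have s1 : `|s| <= 1.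
  apply: le_trans (ler_norm_sum _ _ _) _.
  apply: (@le_trans _ _ (\sum_(i < n) l (lift ord0 i))); last by have := l0 ord0; lra.
  by apply: ler_sum => i _; rewrite normrZ a1 mulr1 ger0_norm.
have := c2 (l ord0) (a ord0) s; rewrite a1 mulr1 (ger0_norm (l0 ord0)) => H2.
have : d * (l ord0 + `|s|) <= d * 2 by rewrite ler_wpM2l//; lra.
have -> : c (l ord0 *: a ord0 + s) - (l ord0 * c (a ord0) + t)
  = (c (l ord0 *: a ord0 + s) - l ord0 * c (a ord0) - c s) + (c s - t) by ring.
have := ler_normD (c (l ord0 *: a ord0 + s) - l ord0 * c (a ord0) - c s) (c s - t).
by rewrite -natr1; lra.
Qed.

Lemma Daug_ge_half n :
  (forall d : R, 0 < d -> exists (u : X) c, almost_functional d u c) ->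
  ((2^-1 : R)%:E <= Daug X n 4^-1)%E.
Proof.
move=> H; have n0 : (0 : R) <= n%:R by [].
have m0 : 0 < 4 * (5 + 2 * n%:R) :> R by lra.
(* A distance below 1/2 would force [1/4 <= (9/2) * d + 2 * n * d], which this choice excludes. *)
pose d : R := (4 * (5 + 2 * n%:R))^-1.
have d0 : 0 < d by rewrite invr_gt0.
have dE : d * (5 + 2 * n%:R) = 4^-1 by rewrite /d; field; rewrite gt_eqF//; lra.
have dn : 0 <= d * n%:R by rewrite mulr_ge0// ltW.
have [u [c uc]] := H d d0; have [u1 cu c1 c2 c3] := uc.
apply: (@le_trans _ _ (dist_set (convn n (lplus u 4^-1)) (- u))); last first.
  apply: ereal_sup_ubound; exists (u, - u) => //=.
  by split=> //=; rewrite /unit_sphere/= normrN.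
apply: le_ereal_inf_tmp => _ [_ [a [l [aP l0 l1 ->]]] <-]; rewrite lee_fin opprK.
have a1 k : `|a k| = 1 by have [] := aP k.
(* The part [a k - c (a k) *: u] has norm at most [1 + d], so [|1 + c (a k)|] is at least [3/4 - d];
   a negative [1 + c (a k)] is impossible because it would be at least [- d]. *)
have ca k : - 4^-1 - d <= c (a k).
  have [_ ua] := aP k; have H3 := c3 (a k); rewrite a1 mulr1 in H3.
  have H1 := c1 (a k); rewrite a1 mulr1 in H1.
  have : `|u + a k| <= `|a k - c (a k) *: u| + `|1 + c (a k)|.
    have -> : u + a k = (a k - c (a k) *: u) + (1 + c (a k)) *: u.
      by rewrite scalerDl scale1r [X in _ = _ + X]addrC addrA subrK addrC.
    by apply: le_trans (ler_normD _ _) _; rewrite normrZ u1 mulr1.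
  have := lerNnormlW H1.
  have [h|h] := leP 0 (1 + c (a k)); [rewrite (ger0_norm h)|rewrite (ltr0_norm h)]; lra.
set z := \sum_k l k *: a k.
have z1 : `|z| <= 1.
  apply: le_trans (ler_norm_sum _ _ _) _; rewrite -l1.
  by apply: ler_sum => i _; rewrite normrZ a1 mulr1 ger0_norm.
have sc : - 4^-1 - d <= \sum_k l k * c (a k).
  have -> : - 4^-1 - d = \sum_k l k * (- 4^-1 - d) by rewrite -mulr_suml l1 mul1r.
  by apply: ler_sum => k _; rewrite ler_wpM2l.
have l1' : \sum_k l k <= 1 by rewrite l1.
have := almost_functional_sum uc (ltW d0) a1 l0 l1'; rewrite -/z => /lerNnormlW H1.
have := c2 1 z u; rewrite scale1r normr1 !mul1r u1 => /lerNnormlW H2.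
have : d * (`|z| + 1) <= d * 2 by rewrite ler_wpM2l// ?(ltW d0)//; lra.
move/lerNnormlW : cu => H3 H4.
have := le_trans (ler_norm _) (c1 (z + u)) => H5.
have [h|h] := leP 2^-1 `|z + u|; first by [].
have : (1 + d) * `|z + u| <= (1 + d) * 2^-1 by rewrite ler_wpM2l ?ltW//; lra.
lra.
Qed.

End NotUniform.

(** * Spreading on a dense set implies the Daugavet property *)

Section DaugavetCriterion.
Variables (R : realType) (X : normedModType R) (D : set X).
Hypothesis dense_D : forall (q : X) (e : R), 0 < e -> exists2 x, D x & `|q - x| <= e.
Hypothesis spread_D : forall (d : R) x y, D x -> D y -> 0 < d ->
  exists M (z : 'I_M -> X), (0 < M)%N /\
   [/\ forall i, `|z i| <= (1 + d) * `|y|,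
       forall i, (1 - d) * (`|x| + `|y|) <= `|x + z i|
     & `|M%:R^-1 *: (\sum_i z i) - y| <= d * `|y|].

(* Since all values of [T] lie on a line, some [z i] has an image close to that
   of [y], and [x] is chosen close to [T y]. *)
Lemma rank_one_spread (T : {linear X -> X}) (e : R) :
  bounded_operator T -> rank_one T -> 0 < e -> e <= 1 ->
  exists2 z : X, `|z| <= 1 + 3 * e &
    1 + opnorm T - (8 + 7 * opnorm T + (opnorm T)^-1) * e <= `|z + T z|.
Proof.
move=> bT [v v0 rT] e0 e1; set S := opnorm T.
have TS x : `|T x| <= S * `|x| by exact: le_opnorm.
have /choice[phi Tphi] q : exists a, T q = a *: v.
  have : range T (T q) by exists q.
  by rewrite rT => -[a _ <-]; exists a.
have nv : 0 < `|v| by rewrite normr_gt0.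
have S0 : 0 < S.
  have [x _ Tx] : range T v by rewrite rT; exists 1 => //; rewrite scale1r.
  have := TS x; rewrite Tx => h.
  have : 0 < S * `|x| by exact: lt_le_trans h.
  by rewrite pmulr_lgt0// normr_gt0; apply: contra_neq v0 => x0; rewrite -Tx x0 linear0.
have [_ [y0 /= y01 <-] Ty0] := sup_adherent e0 (opnorm_has_sup bT).
rewrite -/(opnorm T) -/S in Ty0.
have [y Dy y0y] := dense_D y0 e0.
have [x Dx yx] := dense_D (T y) e0.
have [M [z [M0 [z1 z2 z3]]]] := spread_D Dx Dy e0.
have ny : `|y| <= 1 + e.
  by have := ler_distD y0 0 y; rewrite !sub0r !normrN; lra.
have Ty : S - e - S * e <= `|T y|.
  have := ler_distD (T y) 0 (T y0); rewrite !sub0r !normrN distrC -linearB.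
  have : S * `|y0 - y| <= S * e by rewrite ler_pM2l.
  have := TS (y0 - y); lra.
(* With the sign of [phi y], the numbers [s * phi (z i)] have mean close to [|phi y|], so one of
   them is nearly that large. *)
pose t := phi y; pose s : R := if 0 <= t then 1 else -1.
have s1 : `|s| = 1 by rewrite /s; case: ifP; rewrite ?normrN normr1.
have st : s * t = `|t|.
  by rewrite /s; case: (leP 0 t) => [/ger0_norm|/ltr0_norm] ->; rewrite ?mul1r ?mulN1r.
have [i si] := exists_ge_mean (fun i => s * phi (z i)) M0.
have ee : e * e <= e by rewrite ger_pMr.
have Se : 0 <= S * e by rewrite mulr_ge0// ltW.
have See : S * e * e <= S * e by rewrite ler_piMr.
have Sny : S * `|y| <= S * (1 + e) by rewrite ler_pM2l.
exists (z i).
  have := z1 i; have : (1 + e) * `|y| <= (1 + e) * (1 + e).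
    by rewrite ler_wpM2l// addr_ge0// ltW.
  lra.
have avg : `|T (M%:R^-1 *: (\sum_i z i) - y)| <= 2 * S * e.
  apply: le_trans (TS _) _; apply: (@le_trans _ _ (S * (e * (1 + e)))).
    by rewrite ler_pM2l// (le_trans z3)// ler_pM2l.
  lra.
have TyE : `|T y| = `|t| * `|v| by rewrite Tphi normrZ.
have TzE : T (M%:R^-1 *: (\sum_i z i) - y) = (M%:R^-1 * (\sum_i phi (z i)) - t) *: v.
  rewrite linearB linearZ/= linear_sum Tphi -/t scalerBl -scalerA scaler_suml.
  by congr (_ *: _ - _); apply: eq_bigr => k _; rewrite Tphi.
(* On the line spanned by [v], the signed size of [T (z i)] is bounded below by the choice of [i]
   and above by [opnorm T * |z i|]; both bounds are close to [|T y|]. *)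
have close : `|T y - T (z i)| <= (4 * S + 1) * e.
  have sN r : `|r| = `|s * r| by rewrite normrM s1 mul1r.
  rewrite !Tphi -/t -scalerBl normrZ sN mulrBr st -(ger0_norm (ltW nv)) -normrM.
  rewrite ler_norml mulrBl -TyE.
  have : s * phi (z i) * `|v| <= S * (1 + 3 * e).
    apply: (@le_trans _ _ `|T (z i)|).
      by rewrite Tphi normrZ ler_pM2r// [leRHS]sN ler_norm.
    apply: le_trans (TS _) _; rewrite ler_pM2l// (le_trans (z1 i))//.
    have : (1 + e) * `|y| <= (1 + e) * (1 + e).
      by rewrite ler_wpM2l// addr_ge0// ltW.
    lra.
  have : `|T y| - 2 * S * e <= s * phi (z i) * `|v|.
    apply: le_trans (ler_wpM2r (ltW nv) si); move: avg.
    rewrite TzE normrZ sN mulrBr st TyE -mulr_sumr mulrCA.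
    rewrite -(ger0_norm (ltW nv)) -normrM mulrBl => /lerNnormlW.
    by rewrite normr_id; lra.
  by move=> H1 H2; apply/andP; split; lra.
have x1 : S - 2 * e - S * e <= `|x|.
  by have := ler_distD x 0 (T y); rewrite !sub0r !normrN; rewrite distrC in yx; lra.
have x2 : `|x| <= 2 * S + 1.
  have := ler_distD (T y) 0 x; rewrite !sub0r !normrN; have := TS y.
  have : S * (1 + e) <= S * 2 by rewrite ler_pM2l//; lra.
  lra.
(* [T] nearly attains its norm at [y], so [y] cannot be much shorter than 1; dividing by [S]
   produces the term [(opnorm T)^-1] of the error. *)
have y1 : 1 - S^-1 * e - e <= `|y|.
  rewrite -(ler_pM2l S0); apply: le_trans (TS y); apply: le_trans Ty.
  by rewrite !mulrBr mulr1 mulrA divff ?mul1r// gt_eqF.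
have big : `|x + z i| <= `|z i + T (z i)| + e + (4 * S + 1) * e.
  have -> : x + z i = (z i + T (z i)) + (x - T y) + (T y - T (z i)).
    by rewrite addrC [RHS]addrAC; exact: addr_split.
  apply: le_trans (ler_normD _ _) _; rewrite lerD//.
  by apply: le_trans (ler_normD _ _) _; rewrite lerD2l distrC.
have := z2 i.
have : e * (`|x| + `|y|) <= e * (2 * S + 1 + 2) by rewrite ler_pM2l// lerD//; lra.
lra.
Qed.

Lemma Daugavet_criterion : Daugavet_property X.
Proof.
move=> T bT rT; have TS x := le_opnorm x bT.
have S0 := opnorm_ge0 bT.
have linI : linear (fun x => x + T x).
  by move=> a x y; rewrite linearP scalerDr addrACA.
pose I : {linear X -> X} := HB.pack (fun x => x + T x)
  (GRing.isLinear.Build _ _ _ _ (fun x => x + T x) linI).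
have IB x : `|I x| <= (1 + opnorm T) * `|x|.
  by apply: le_trans (ler_normD _ _) _; rewrite mulrDl mul1r lerD2l.
have bI : bounded_operator I by exists (1 + opnorm T).
have up : opnorm I <= 1 + opnorm T by apply: opnorm_le => //; rewrite addr_ge0.
apply/eqP; rewrite eq_le up/=; apply/ler_addgt0Pl => g g0.
(* The last summand of [C] pays for [z] having norm up to [1 + 3 * e] instead of 1. *)
set S := opnorm T; set C := 8 + 7 * S + S^-1 + 3 * (1 + S).
have Si : 0 <= S^-1 by rewrite invr_ge0.
have S1 : 0 <= S := S0.
have C0 : 0 < C by rewrite /C; lra.
pose e := Num.min 1 (g / C).
have e0 : 0 < e by rewrite lt_min ltr01 divr_gt0.
have e1 : e <= 1 by rewrite ge_min lexx.
have eC : e * C <= g by rewrite -ler_pdivlMr// ge_min lexx orbT.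
have [z z1 z2] := rank_one_spread bT rT e0 e1.
have := le_opnorm z bI.
have : opnorm I * `|z| <= (1 + S) * (3 * e) + opnorm I.
  apply: le_trans (ler_wpM2l (opnorm_ge0 bI) z1) _.
  have : opnorm I * (3 * e) <= (1 + S) * (3 * e).
    by rewrite ler_wpM2r// mulr_ge0// ltW.
  lra.
rewrite -[`|I z|]/(`|z + T z|) -/S in z2 *; move: eC; rewrite /C; lra.
Qed.

End DaugavetCriterion.

(** * The ultrapower *)

Section ExtendFunctional.
Variables (R : realType) (E X : normedModType R) (f : E -> X).
Hypothesis f_lin : forall a x y, f (a *: x + y) = a *: f x + f y.
Hypothesis f_norm : forall x, `|f x| = `|x|.
Hypothesis f_dense : forall q (e : R), 0 < e -> exists x, `|q - f x| <= e.

Lemma isometry0 : f 0 = 0.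
Proof. by apply/eqP; rewrite -normr_eq0 f_norm normr0. Qed.

Lemma isometryZ a x : f (a *: x) = a *: f x.
Proof. by rewrite -[a *: x]addr0 f_lin isometry0 addr0. Qed.

Lemma isometryD x y : f (x + y) = f x + f y.
Proof. by rewrite -[x in LHS]scale1r f_lin scale1r. Qed.

Lemma isometryB x y : f (x - y) = f x - f y.
Proof. by rewrite addrC -scaleN1r f_lin scaleN1r addrC. Qed.

Lemma isometry_sum M (z : 'I_M -> E) : f (\sum_i z i) = \sum_i f (z i).
Proof. exact: (big_morph f isometryD isometry0). Qed.

(** [c] is composed with a choice [g] of nearby points of [E]. This [g] need not be linear, but only
    almost linearity is required. *)
Lemma extend_functional :
  (forall d : R, 0 < d -> exists (u : E) c, almost_functional d u c) ->
  forall d : R, 0 < d -> exists (u : X) c, almost_functional d u c.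
Proof.
(* The factor 10 comes from the linearity defect: 4 for splitting [g (a *: p + q)] as [r + b], 4 for
   [c r], and 2 for splitting [b]. *)
move=> H d d0; pose t := Num.min 1 (d / 10).
have t0 : 0 < t by rewrite lt_min ltr01 divr_gt0.
have t1 : t <= 1 by rewrite ge_min lexx.
have td : 10 * t <= d by rewrite mulrC -ler_pdivlMr// ge_min lexx orbT.
have tt : t * t <= t by rewrite ger_pMr.
have [u [c [u1 cu c1 c2 c3]]] := H t t0.
(* The error is relative to [|q|], as the bounds to be proved scale with the argument; hence the
   separate case [q = 0]. *)
have /choice[g gE] q : exists x, `|q - f x| <= t * `|q|.
  have [->|q0] := eqVneq q 0.
    by exists 0; rewrite isometry0 subrr normr0 mulr0.
  by apply: f_dense; rewrite mulr_gt0// normr_gt0.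
have gN q : `|g q| <= (1 + t) * `|q|.
  rewrite -f_norm; have := ler_distD q 0 (f (g q)).
  by rewrite !sub0r !normrN; have := gE q; lra.
have tN (s : R) : 0 <= s -> t * s <= s /\ t * t * s <= t * s.
  by move=> s0; split; [rewrite -[leRHS]mul1r ler_wpM2r|rewrite ler_wpM2r].
have cN x s : 0 <= s -> `|x| <= s -> `|c x| <= 2 * s.
  move=> s0 xs; apply: le_trans (c1 x) _.
  by apply: ler_pM => //; [rewrite addr_ge0// ltW|lra].
exists (f u), (fun q => c (g q)); split.
- by rewrite f_norm.
- set r := g (f u) - u.
  have r1 : `|r| <= t.
    by rewrite -f_norm isometryB distrC; have := gE (f u); rewrite f_norm u1 mulr1.
  have := c2 1 r u; rewrite scale1r normr1 !mul1r u1 subrK => h1.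
  have h2 := cN r t (ltW t0) r1.
  have h3 : t * (`|r| + 1) <= t * 2 by rewrite ler_pM2l//; lra.
  have -> : c (g (f u)) - 1 = (c (g (f u)) - c r - c u) + c r + (c u - 1) by ring.
  apply: le_trans (ler_normD _ _) _.
  have := ler_normD (c (g (f u)) - c r - c u) (c r); lra.
- move=> q; apply: le_trans (c1 _) _; have := gN q => h.
  have : (1 + t) * `|g q| <= (1 + t) * ((1 + t) * `|q|).
    by rewrite ler_wpM2l// addr_ge0// ltW.
  have [h1 h2] := tN `|q| (normr_ge0 q).
  have : 10 * t * `|q| <= d * `|q| by rewrite ler_wpM2r.
  have := mulr_ge0 (ltW t0) (normr_ge0 q); lra.
- move=> a p q; set s := `|a| * `|p| + `|q|.
  have s0 : 0 <= s by rewrite addr_ge0// mulr_ge0.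
  set b := a *: g p + g q; set r := g (a *: p + q) - b.
  have ps : `|a *: p + q| <= s by rewrite (le_trans (ler_normD _ _))// normrZ.
  have r1 : `|r| <= 2 * t * s.
    rewrite -f_norm isometryB f_lin.
    have -> : f (g (a *: p + q)) - (a *: f (g p) + f (g q)) =
      (a *: (p - f (g p)) + (q - f (g q))) - (a *: p + q - f (g (a *: p + q))).
      by rewrite scalerBr opprD addrA; exact: addr_cancel3.
    apply: le_trans (ler_normB _ _) _.
    have := ler_normD (a *: (p - f (g p))) (q - f (g q)); rewrite normrZ.
    have := ler_wpM2l (normr_ge0 a) (gE p); have := gE q; have := gE (a *: p + q).
    have : t * `|a *: p + q| <= t * s by rewrite ler_pM2l.
    by rewrite /s; lra.
  have hpq : `|a| * `|g p| + `|g q| <= (1 + t) * s.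
    have := ler_wpM2l (normr_ge0 a) (gN p); have := gN q; rewrite /s; lra.
  have b1 : `|b| <= (1 + t) * s.
    by apply: le_trans hpq; apply: le_trans (ler_normD _ _) _; rewrite normrZ.
  have := c2 1 r b; rewrite scale1r normr1 !mul1r subrK => h1.
  have ts0 : 0 <= 2 * t * s by rewrite !mulr_ge0// ltW.
  have h2 := cN r _ ts0 r1.
  have h3 : t * (`|r| + `|b|) <= t * (2 * t * s + (1 + t) * s).
    by rewrite ler_pM2l// lerD.
  have h4 := c2 a (g p) (g q); rewrite -/b in h4.
  have h5 : t * (`|a| * `|g p| + `|g q|) <= t * ((1 + t) * s) by rewrite ler_pM2l.
  have [_ h6] := tN s s0.
  have h7 : 10 * t * s <= d * s by rewrite ler_wpM2r.
  have -> : c (g (a *: p + q)) - a * c (g p) - c (g q) =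
    (c (g (a *: p + q)) - c r - c b) + c r + (c b - a * c (g p) - c (g q)) by ring.
  apply: le_trans (ler_normD _ _) _.
  have := ler_normD (c (g (a *: p + q)) - c r - c b) (c r); lra.
- move=> q; have -> : q - c (g q) *: f u = (q - f (g q)) + f (g q - c (g q) *: u).
    by rewrite isometryB isometryZ addrA subrK.
  apply: le_trans (ler_normD _ _) _; rewrite f_norm.
  have h1 := gE q; have h2 := c3 (g q).
  have : (1 + t) * `|g q| <= (1 + t) * ((1 + t) * `|q|).
    by rewrite ler_wpM2l// addr_ge0// ltW.
  have [h3 h4] := tN `|q| (normr_ge0 q).
  have : 10 * t * `|q| <= d * `|q| by rewrite ler_wpM2r.
  have := mulr_ge0 (ltW t0) (normr_ge0 q); lra.
Qed.

End ExtendFunctional.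

Lemma Daugavet_space_exists (R : realType) : exists X : completeNormedModType R,
  Daugavet_property X /\
  forall d : R, 0 < d -> exists (u : X) c, almost_functional d u c.
Proof.
have [N [sN N0 spr fct]] := norm_exists R.
pose E : normedModType R := renormed sN N0.
have [X [f [f_lin f_norm f_dense]]] := completion_exists E.
exists X; split.
  apply: (@Daugavet_criterion R X (range f)).
    by move=> q e /(f_dense q)[x qx]; exists (f x) => //; exists x.
  move=> d _ _ [x _ <-] [y _ <-] d0; have [M [z [M0 [z1 z2 z3]]]] := spr d x y d0.
  exists M, (fun i => f (z i)); split=> //; split=> [i|i|].
  - by rewrite !f_norm; exact: z1.
  - by rewrite -(isometryD f_lin) !f_norm; exact: z2.
  - rewrite -(isometry_sum f_lin f_norm) -(isometryZ f_lin f_norm) -(isometryB f_lin).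
    by rewrite !f_norm; exact: z3.
apply: (extend_functional f_lin f_norm f_dense) => d d0.
have [u [c [u1 cu c1 c2 c3]]] := fct d d0; exists u, c; split=> //.
by rewrite cu subrr normr0 ltW.
Qed.

(** * The limit functional on the ultrapower *)

Section Ultrapower.
Variables (R : realType) (X : normedModType R) (U : freeUltrafilter).
Variables (u : nat -> X) (c : nat -> X -> R).
Hypothesis uc : forall i, almost_functional i.+1%:R^-1 (u i) (c i).

Let d (i : nat) : R := i.+1%:R^-1.

Let d_ge0 i : 0 <= d i.
Proof. by rewrite invr_ge0. Qed.

Let d_le1 i : d i <= 1.
Proof. by rewrite invf_le1// ler1n. Qed.

Let u1 i : `|u i| = 1. Proof. by case: (uc i). Qed.

Let c_le i p : `|c i p| <= 2 * `|p|.
Proof.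
have [_ _ h _ _] := uc i; apply: le_trans (h p) _.
by rewrite ler_wpM2r// -[2]/(1 + 1) lerD2l; exact: d_le1.
Qed.

Let c_lin i a p q :
  `|c i (a *: p + q) - a * c i p - c i q| <= d i * (`|a| * `|p| + `|q|).
Proof. by case: (uc i). Qed.

Lemma cvg_inv_ultra : d i @[i --> fu_sets U] --> (0 : R).
Proof.
have /cvgrPdist_le h := @cvg_harmonic R; apply/cvgrPdist_le => e e0.
have [n _ hn] := h e e0.
by apply: filterS (fu_geq U n) => i /= /hn.
Qed.

(** The limit is taken on the chosen representative; [ufunP] shows that every representative gives
    the same value. *)
Definition ufun (q : ultrapower X U) : R :=
  lim (c i (up_repr q i) @[i --> fu_sets U]).

Lemma linfty_bound (y : linfty X) : exists2 B : R, 0 <= B & forall i, `|y i| <= B.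
Proof.
have /asboolP[B yB] := linfty_valP y; exists B => //.
exact: le_trans (normr_ge0 (y 0%N)) (yB 0%N).
Qed.

Lemma cvg_c (y : linfty X) : cvg (c i (y i) @[i --> fu_sets U]).
Proof.
have [B B0 yB] := linfty_bound y; apply: (@fu_cvg U R _ (2 * B)) => i.
by apply: le_trans (c_le i _) _; rewrite ler_pM2l.
Qed.

Lemma ultra_cvg_eq0 (g h : nat -> R) (l : R) : g i @[i --> fu_sets U] --> l ->
  h i @[i --> fu_sets U] --> (0 : R) -> (forall i, `|g i| <= h i) -> l = 0.
Proof.
move=> gl h0 gh; apply/eqP; rewrite -normr_le0.
apply: (ler_cvg_to (cvg_norm gl) h0); exact: nearW gh.
Qed.

(** For two representatives the values of [c i] differ by at most [3 * |x i - y i| + d i * B], which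
    tends to 0 along [U]. *)
Lemma ufunP (y : linfty X) : c i (y i) @[i --> fu_sets U] --> ufun (up_class U y).
Proof.
set x := up_repr (up_class U y).
have [B B0 yB] := linfty_bound y.
have n0 : `|(x - y) i| @[i --> fu_sets U] --> (0 : R).
  have <- : ulim_norm U (x - y) = 0 by apply/up_classP; rewrite up_reprK.
  exact: ulim_normP.
have cx : c i (x i) @[i --> fu_sets U] --> ufun (up_class U y) by exact: cvg_c.
suff <- : lim (c i (y i) @[i --> fu_sets U]) = ufun (up_class U y) by exact: cvg_c.
apply/esym/subr0_eq; apply: (ultra_cvg_eq0 (cvgB cx (cvg_c (y := y)))).
  have := cvgD (cvgMl_tmp (a := 3) n0) (cvgMr_tmp (b := B) cvg_inv_ultra).
  by rewrite mulr0 mul0r addr0; apply.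
move=> i /=; have := c_lin i 1 (x i - y i) (y i).
rewrite scale1r subrK mul1r normr1 mul1r => h1; have h2 := c_le i (x i - y i).
have h3 : d i * (`|x i - y i| + `|y i|) <= `|x i - y i| + d i * B.
  by rewrite mulrDr lerD ?ler_wpM2l// ler_piMl.
have := ler_normD (c i (x i) - c i (x i - y i) - c i (y i)) (c i (x i - y i)).
have -> : c i (x i) - c i (x i - y i) - c i (y i) + c i (x i - y i) =
  c i (x i) - c i (y i) by ring.
lra.
Qed.
Arguments ufunP y : clear implicits.

(** The linearity defect of [c i] on bounded sequences is at most a constant times [d i], so it
    disappears in the limit. *)
Lemma ufun_linear a p q : ufun (a *: p + q) = a * ufun p + ufun q.
Proof.
rewrite -(up_reprK p) -(up_reprK q); set y := up_repr p; set z := up_repr q.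
have -> : a *: up_class U y + up_class U z = up_class U (a *: y + z).
  by rewrite up_classD up_classZ.
have [B B0 yB] := linfty_bound y; have [C C0 zC] := linfty_bound z.
apply/subr0_eq; rewrite opprD addrA.
have d0 : d i * (`|a| * B + C) @[i --> fu_sets U] --> (0 : R).
  by have := cvgMr_tmp (b := `|a| * B + C) cvg_inv_ultra; rewrite mul0r; apply.
have gl : c i ((a *: y + z) i) - a * c i (y i) - c i (z i) @[i --> fu_sets U] -->
    ufun (up_class U (a *: y + z)) - a * ufun (up_class U y) - ufun (up_class U z).
  apply: cvgB; last exact: ufunP.
  by apply: cvgB; [exact: (ufunP (a *: y + z))|exact: cvgMl_tmp (ufunP y)].
apply: (ultra_cvg_eq0 gl d0).
move=> i /=; apply: le_trans (c_lin i a (y i) (z i)) _.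
by rewrite ler_wpM2l// lerD// ler_wpM2l.
Qed.

Lemma bounded_u : u \in @bounded_seq R X.
Proof. by apply/asboolP; exists 1 => i; rewrite u1. Qed.

Definition uvec : ultrapower X U := up_class U (Linfty bounded_u).

Lemma uvec_norm : `|uvec| = 1.
Proof.
rewrite up_normE; apply: ulim_norm_eq => /=.
rewrite (_ : (fun i => `|u i|) = (fun=> 1)); first exact: cvg_cst.
by apply/funext => i.
Qed.

Lemma ufun_uvec : ufun uvec = 1.
Proof.
have gl : c i (u i) - 1 @[i --> fu_sets U] --> ufun uvec - 1.
  by apply: cvgB; [exact: (ufunP (Linfty bounded_u))|exact: cvg_cst].
apply/subr0_eq; apply: (ultra_cvg_eq0 gl cvg_inv_ultra).
by move=> i /=; case: (uc i).
Qed.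

(** In the limit the factor [1 + d i] becomes 1, and replacing [c i (y i)] by its limit costs a null
    term. *)
Lemma ufun_shift q : `|q - ufun q *: uvec| <= `|q|.
Proof.
rewrite -(up_reprK q); set y := up_repr q; set a := ufun _.
have -> : up_class U y - a *: uvec = up_class U (y - a *: Linfty bounded_u).
  by rewrite up_classB up_classZ.
rewrite !up_normE.
have h : (1 + d i) * `|y i| + `|c i (y i) - a| @[i --> fu_sets U] --> ulim_norm U y.
  have ca : `|c i (y i) - a| @[i --> fu_sets U] --> (0 : R).
    by have := cvg_norm (cvgB (ufunP y) (cvg_cst a)); rewrite -/a subrr normr0; apply.
  have := cvgD (cvgM (cvgD (cvg_cst (1 : R)) cvg_inv_ultra) (ulim_normP U y)) ca.
  by rewrite !addr0 mul1r; apply.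
apply: (ler_cvg_to (ulim_normP U _) h); apply: nearW => i.
rewrite linftyDE linftyNE linftyZE /=.
have -> : y i - a *: u i = (y i - c i (y i) *: u i) + (c i (y i) - a) *: u i.
  by rewrite scalerBl addrA subrK.
apply: le_trans (ler_normD _ _) _; rewrite normrZ u1 mulr1 lerD2r.
by case: (uc i).
Qed.

(** The operator sending [q] to [- ufun q *: uvec] maps [uvec] to [- uvec], so its norm is at least
    1; the Daugavet equation would give its sum with the identity norm at least 2, but that norm is
    at most 1. *)
Lemma ultrapower_not_Daugavet : ~ Daugavet_property (ultrapower X U).
Proof.
move=> DP.
have linT : linear (fun q => - ufun q *: uvec).
  by move=> a p q; rewrite ufun_linear opprD scalerDl -mulrN -scalerA.
pose T : {linear ultrapower X U -> ultrapower X U} := HB.pack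
  (fun q => - ufun q *: uvec) (GRing.isLinear.Build _ _ _ _ (fun q => - ufun q *: uvec) linT).
have bT : bounded_operator T.
  exists 2 => q /=; rewrite normrZ uvec_norm mulr1 normrN.
  have := ufun_shift q; have := ler_distD q 0 (ufun q *: uvec).
  by rewrite !sub0r !normrN normrZ uvec_norm mulr1; lra.
have rT : rank_one T.
  exists uvec; first by rewrite -normr_eq0 uvec_norm oner_eq0.
  apply/seteqP; split=> [_ [q _ <-]|_ [a _ <-]]; first by exists (- ufun q).
  exists (- a *: uvec) => //=.
  have f0 : ufun 0 = 0.
    by have := ufun_linear (-1) uvec uvec; rewrite scaleN1r addNr mulN1r addNr.
  have := ufun_linear (- a) uvec 0; rewrite addr0 ufun_uvec mulr1 f0 addr0 => ->.
  by rewrite opprK.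
have := DP T bT rT.
have T1 : 1 <= opnorm T.
  have := le_opnorm uvec bT; rewrite uvec_norm mulr1; apply: le_trans.
  by rewrite /= ufun_uvec normrZ uvec_norm normrN normr1 mulr1.
have : opnorm (fun q => q + T q) <= 1.
  apply: ge_sup; first by exists `|0 + T 0|, 0 => //=; rewrite normr0.
  move=> _ [q /= q1 <-]; rewrite scaleNr; exact: le_trans (ufun_shift q) q1.
lra.
Qed.

End Ultrapower.

(** * The three statements, from one space *)

Theorem theorem3p3 (R : realType) :
  [/\ (forall n : nat, exists X : completeNormedModType R,
         [/\ nonzero_space X, Daugavet_property X
           & ((2^-1 : R)%:E <= Daug X n 4^-1)%E]),
      (exists X : completeNormedModType R,
         [/\ nonzero_space X, Daugavet_property X
           & ~ uniform_Daugavet_property X])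
    & (exists (X : completeNormedModType R) (U : freeUltrafilter),
         [/\ nonzero_space X, Daugavet_property X
           & ~ Daugavet_property (ultrapower X U : completeNormedModType R)])].
Proof.
have [X [DX fX]] := Daugavet_space_exists R.
have nX : nonzero_space X.
  have [u [c [u1 _ _ _ _]]] := fX 1 ltr01; exists u.
  by rewrite -normr_eq0 u1 oner_eq0.
have hX n := Daug_ge_half n fX.
split.
- by move=> n; exists X.
(* The lower bound 1/2 holds on the same space for every [n], so the limit along [n] cannot be 0. *)
- exists X; split=> // /(_ 4^-1); rewrite invr_gt0 ltr0n => /(_ isT) H.
  have : ((2^-1 : R)%:E <= 0)%E by apply: (cvge_to_ge H); exact: nearW.
  by rewrite lee_fin; lra.
- have [U] := free_ultrafilter_exists; exists X, U; split=> //.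
  have /choice[u /choice[c uc]] (i : nat) : exists (u : X) c,
      almost_functional i.+1%:R^-1 u c by apply: fX; rewrite invr_gt0.
  exact: ultrapower_not_Daugavet uc.
Qed.
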